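(* Let $(\Gamma,\pi)$ be a weighted graph with vertex set $G$, let $(\theta_x)_{x\in G}$ be positive vertex weights such that $\sum_{x\in U}\theta_x=\infty$ for every infinite connected $U\subset G$, let $\rho$ be a metric on $G$ adapted to $\mathcal{L}_\theta$, and let $\mu := VG(\Gamma,\pi,\theta,\rho)\in[0,\infty]$ be the exponential volume growth. Suppose that there exist positive constants $m,M$ such that $m\leq \rho(x,y)\leq M$ whenever $x\sim y$. Then the bottom of the essential spectrum of $-\mathcal{L}_\theta$ satisfies $$\lambda^{ess}_0(\Gamma,\pi,\theta) \leq \frac{1}{m^2}\,\frac{\bigl(1-\exp(\frac{1}{2}M\mu)\bigr)^2}{1+\exp(M\mu)},$$ where for $\mu=\infty$ the right-hand side is interpreted as its limit $\frac{1}{m^2}$.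
   Context: Graph: $\Gamma=(G,E)$ is an unoriented, connected, countably infinite, locally finite graph without loops or multiple edges; $x\sim y$ means $\{x,y\}\in E$. A subset $U\subset G$ is connected if it induces a connected subgraph. Edge weights: $\pi_{xy}=\pi_{yx}\ge 0$ for $x,y\in G$, with $\pi_{xy}>0$ if and only if $\{x,y\}\in E$; $(\Gamma,\pi)$ is then called a weighted graph. Operator: $L^2(\theta)$ is the real Hilbert space with inner product $\langle f,g\rangle_{L^2(\theta)}=\sum_{x\in G}f(x)g(x)\theta_x$. The operator $\mathcal{L}_\theta$ is given by $(\mathcal{L}_\theta f)(x)=\frac{1}{\theta_x}\sum_{y\sim x}\pi_{xy}(f(y)-f(x))$ on the domain $\{f\in L^2(\theta):\mathcal{L}_\theta f\in L^2(\theta)\}$. Under the stated condition on $\theta$, $-\mathcal{L}_\theta$ is a nonnegative self-adjoint operator; it is minus the generator of the Dirichlet form $\mathcal{E}(f,g)=\frac12\sum_{x,y\in G}\pi_{xy}(f(y)-f(x))(g(y)-g(x))$ whose domain $\mathcal{D}(\mathcal{E})$ is the closure of the finitely supported functions $C_c(G)$ in the norm $(\|f\|_{L^2(\theta)}^2+\mathcal{E}(f,f))^{1/2}$. Adapted metric: a metric $\rho$ on $G$ is adapted to $\mathcal{L}_\theta$ on $(\Gamma,\pi)$ if $\frac{1}{\theta_x}\sum_{y\sim x}\pi_{xy}\rho^2(x,y)\le 1$ for all $x\in G$, and there is $c_\rho>0$ such that $\rho(x,y)\le c_\rho$ whenever $x\sim y$. Volume growth: $B_\rho(x_0,r)=\{x\in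 G:\rho(x_0,x)\le r\}$, $V_\rho(x_0,r)=\sum_{x\in B_\rho(x_0,r)}\theta_x\in(0,\infty]$, and $VG(\Gamma,\pi,\theta,\rho)=\limsup_{r\to\infty}\frac1r\log V_\rho(x_0,r)$, which does not depend on $x_0\in G$. Spectrum: the essential spectrum of $-\mathcal{L}_\theta$ consists of the points of its spectrum that are accumulation points of the spectrum or isolated eigenvalues of infinite multiplicity; $\lambda_0^{ess}(\Gamma,\pi,\theta)$ is its infimum, equal to $+\infty$ if the essential spectrum is empty. *)

(* Defs.v *)
From mathcomp Require Import all_boot all_order all_algebra.
From mathcomp Require Import all_classical all_reals all_analysis.
Set Implicit Arguments.
Unset Strict Implicit.
Unset Printing Implicit Defensive.
Import Order.TTheory GRing.Theory Num.Theory.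
Import numFieldNormedType.Exports.

Local Open Scope classical_set_scope.
Local Open Scope ring_scope.

Definition connected_in (G : eqType) (E : rel G) (U : set G) : Prop :=
  forall x y, U x -> U y ->
    exists p : seq G,
      [/\ path E x p, last x p = y & forall z, z \in p -> U z].

Record weighted_graph (R : realType) (G : countType)
    (E : rel G) (w : G -> G -> R) : Prop := {
  wg_infinite : infinite_set [set: G];
  wg_edge_sym : symmetric E;
  wg_edge_irr : irreflexive E;
  wg_locally_finite : forall x, finite_set [set y | E x y];
  wg_connected : connected_in E [set: G];
  wg_weight_sym : forall x y, w x y = w y x;
  wg_weight_ge0 : forall x y, 0 <= w x y;
  wg_weight_gt0 : forall x y, 0 < w x y <-> E x y
}.

(* Spectral theory of an operator A with domain D in a normed space which is
   given as the subset H of an ambient vector space V, with norm N on H.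
   Only real spectral values are considered: a self-adjoint operator has real
   spectrum, and a real number is in the spectrum of a real operator iff it is
   in the spectrum of its complexification. *)
Section spectrum.
Context {R : realType} {V : lmodType R}.
Variables (H : set V) (N : V -> R) (D : set V) (A : V -> V).

(* The last clause is the boundedness of the inverse of A - lam. *)
Definition resolvent_set : set R :=
  [set lam | set_bij D H (fun f => A f - lam *: f) /\
             exists C : R, forall f, D f -> N f <= C * N (A f - lam *: f)].

Definition spectrum : set R := ~` resolvent_set.

Definition eigenspace (lam : R) : set V := [set f | D f /\ A f = lam *: f].

Definition infinite_dimensional (W : set V) : Prop :=
  forall n : nat, exists v : 'I_n -> V,
    (forall i, W (v i)) /\
    (forall c : 'I_n -> R,
        \sum_(i < n) c i *: v i = 0 -> forall i, c i = 0).

Definition essential_spectrum : set R :=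
  [set lam | spectrum lam /\
     (limit_point spectrum lam \/
      (isolated spectrum lam /\ infinite_dimensional (eigenspace lam)))].

Definition bottom_essential_spectrum : \bar R :=
  ereal_inf (EFin @` essential_spectrum).

End spectrum.

Section laplacian.
Context {R : realType} {G : countType}.
Variables (E : rel G) (w : G -> G -> R) (theta : G -> R).

(* The values are put in R^o, which is R as a module over itself, so that
   the functions form a vector space over R. *)
Definition normsqL2 (f : G -> R^o) : \bar R :=
  \esum_(x in [set: G]) ((f x) ^+ 2 * theta x)%:E.

Definition L2 : set (G -> R^o) := [set f | (normsqL2 f < +oo)%E].

Definition normL2 (f : G -> R^o) : R := Num.sqrt (fine (normsqL2 f)).

Definition laplacian (f : G -> R^o) : G -> R^o :=
  fun x => (theta x)^-1 * \sum_(y \in [set y | E x y]) w x y * (f y - f x).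

Definition laplacian_domain : set (G -> R^o) :=
  [set f | L2 f /\ L2 (laplacian f)].

Definition lambda0_ess : \bar R :=
  bottom_essential_spectrum L2 normL2 laplacian_domain
    (fun f => - laplacian f).

End laplacian.

Record is_metric (R : realType) (G : Type) (rho : G -> G -> R) : Prop := {
  metric_eq0 : forall x y, rho x y = 0 <-> x = y;
  metric_ge0 : forall x y, 0 <= rho x y;
  metric_sym : forall x y, rho x y = rho y x;
  metric_triangle : forall x y z, rho x z <= rho x y + rho y z
}.

Record adapted_metric (R : realType) (G : countType) (E : rel G)
    (w : G -> G -> R) (theta : G -> R) (rho : G -> G -> R) : Prop := {
  adapted_is_metric : is_metric rho;
  adapted_sum : forall x,
    (theta x)^-1 * \sum_(y \in [set y | E x y]) w x y * rho x y ^+ 2 <= 1;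
  adapted_jump : exists c : R, 0 < c /\ forall x y, E x y -> rho x y <= c
}.

Definition volume (R : realType) (G : countType) (theta : G -> R)
    (rho : G -> G -> R) (x0 : G) (r : R) : \bar R :=
  \esum_(x in [set x | rho x0 x <= r]) (theta x)%:E.

(* lne is the extended logarithm, with lne +oo = +oo. *)
Definition volume_growth (R : realType) (G : countType) (theta : G -> R)
    (rho : G -> G -> R) (x0 : G) : \bar R :=
  limf_esup (fun r : R => r^-1%:E * lne (volume theta rho x0 r))%E
    (pinfty_nbhs R).

(* At mu = +oo this is the limit of the formula. The value at -oo is
   immaterial, since the volume growth is nonnegative. *)
Definition ess_spectrum_bound (R : realType) (m M : R) (mu : \bar R) : \bar R :=
  match mu with
  | r%:E => ((m ^+ 2)^-1 * ((1 - expR (2^-1 * M * r)) ^+ 2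
                            / (1 + expR (M * r))))%:E
  | +oo%E | -oo%E => ((m ^+ 2)^-1)%:E
  end.

(* Main.v *)
(* Since m <= rho on edges, adaptedness gives sum_y w x y <= theta x / m^2, so
   -L is a bounded symmetric operator on l2(theta), and its essential spectrum
   can be reached by elementary means.

   A normalized weakly null sequence v_j with Rayleigh quotients <= L forces a
   point of the essential spectrum below L: if no point of the spectrum up to L
   is an accumulation point, then one can split off eigenvectors one at a time.
   On the orthogonal complement of the eigenvectors found so far, the infimum l
   of the Rayleigh quotient is at most L (project the v_j) and is isolated in
   the spectrum; with X = A - l the gap gives <X v, v> >= d |v|^2 on the range
   of X, so (1 - X / b)^n u converges geometrically to an eigenvector for l.
   Hence there are arbitrarily many orthonormal eigenvectors below L, and the
   infimum of the levels below which this happens is in the essential spectrum.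

   For finite mu and a > mu / 2 the test functions exp (a (j - |r - j|)), with
   r = rho x0, have Rayleigh quotient at most
   (1 - exp (a M))^2 / (1 + exp (2 a M)) / m^2; they are in l2 because the volume
   grows slower than exp (2 a r), and their norms tend to infinity because theta
   has infinite mass, so once normalized they tend to 0. For infinite mu, delta
   functions at distinct vertices suffice. *)

From HB Require Import structures.
Require Import Defs.
From mathcomp Require Import all_boot all_order all_algebra.
From mathcomp Require Import all_classical all_reals all_analysis.
From mathcomp Require Import ring lra.
Set Implicit Arguments.
Unset Strict Implicit.
Unset Printing Implicit Defensive.
Import Order.TTheory GRing.Theory Num.Theory.
Import numFieldNormedType.Exports.

Local Open Scope classical_set_scope.
Local Open Scope ring_scope.

(** * Bounded symmetric operators *)

(** The quadratic t -> B (t u + v) (t u + v) stays nonnegative, so its discriminant is at most 0.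
    Positivity is asked only on [K], so that the lemma applies to forms <T u, v> that are
    nonnegative on an invariant subspace only. *)
Lemma form_cauchy_schwarz (R : realType) (V : lmodType R) (B : V -> V -> R)
    (K : set V) (u v : V) :
  (forall u v, B u v = B v u) ->
  (forall a u v z, B (a *: u + v) z = a * B u z + B v z) ->
  (forall a u v, K u -> K v -> K (a *: u + v)) ->
  (forall u, K u -> 0 <= B u u) -> K u -> K v ->
  B u v ^+ 2 <= B u u * B v v.
Proof.
move=> BC BL KL B0 Ku Kv.
have H t : 0 <= t ^+ 2 * B u u + 2 * t * B u v + B v v.
  have := B0 _ (KL t _ _ Ku Kv).
  rewrite BL (BC u) (BC v) !BL (BC v u).
  by congr (0 <= _); ring.
have a0 := B0 _ Ku.
have [a1|a1] := eqVneq (B u u) 0.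
  rewrite a1 mul0r; have [->|b0] := eqVneq (B u v) 0; first by rewrite expr0n.
  (* With [B u u = 0] the quadratic is affine, and at this [t] it would equal -1. *)
  have := H (- (B v v + 1) / (2 * B u v)); rewrite a1.
  have -> : (- (B v v + 1) / (2 * B u v)) ^+ 2 * 0 +
     2 * (- (B v v + 1) / (2 * B u v)) * B u v + B v v = -1 by field.
  by rewrite ler0N1.
have {}a1 : 0 < B u u by rewrite lt_neqAle eq_sym a1.
have := H (- B u v / B u u).
have -> : (- B u v / B u u) ^+ 2 * B u u + 2 * (- B u v / B u u) * B u v +
  B v v = (B u u * B v v - B u v ^+ 2) / B u u by field; rewrite gt_eqF.
by rewrite pmulr_lge0 ?invr_gt0// subr_ge0.
Qed.

Record inner_product (R : realType) (V : lmodType R) (ip : V -> V -> R) :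
    Prop := {
  ipC : forall u v, ip u v = ip v u;
  ipL : forall a u v z, ip (a *: u + v) z = a * ip u z + ip v z;
  ip_ge0 : forall u, 0 <= ip u u;
  ip_eq0 : forall u, ip u u = 0 -> u = 0
}.

Section inner_product_theory.
Context {R : realType} {V : lmodType R} (ip : V -> V -> R).
Hypothesis hip : inner_product ip.

Let ip0l v : ip 0 v = 0.
Proof. by have := ipL hip (-1) 0 0 v; rewrite scaler0 addr0; lra. Qed.

Let ipDl u v z : ip (u + v) z = ip u z + ip v z.
Proof. by have := ipL hip 1 u v z; rewrite scale1r mul1r. Qed.

Let ipZl a u z : ip (a *: u) z = a * ip u z.
Proof. by have := ipL hip a u 0 z; rewrite !addr0 ip0l addr0. Qed.

Let ipNl u z : ip (- u) z = - ip u z.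
Proof. by rewrite -scaleN1r ipZl mulN1r. Qed.

Let ip0r v : ip v 0 = 0. Proof. by rewrite (ipC hip) ip0l. Qed.

Let ipDr u v z : ip z (u + v) = ip z u + ip z v.
Proof. by rewrite !(ipC hip z) ipDl. Qed.

Let ipZr a u z : ip z (a *: u) = a * ip z u.
Proof. by rewrite !(ipC hip z) ipZl. Qed.

Let ipNr u z : ip z (- u) = - ip z u.
Proof. by rewrite !(ipC hip z) ipNl. Qed.

Definition ipE := (ip0l, ip0r, ipDl, ipDr, ipNl, ipNr, ipZl, ipZr).

Lemma ip_suml (I : Type) (r : seq I) (P : pred I) (F : I -> V) z :
  ip (\sum_(i <- r | P i) F i) z = \sum_(i <- r | P i) ip (F i) z.
Proof. by apply: (big_morph (ip^~ z)) => [u v|]; rewrite ipE. Qed.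

Definition ipnorm u := Num.sqrt (ip u u).
Local Notation N := ipnorm.

Lemma sqr_ipnorm u : N u ^+ 2 = ip u u.
Proof. by rewrite sqr_sqrtr// (ip_ge0 hip). Qed.

Lemma ipnorm_ge0 u : 0 <= N u. Proof. exact: sqrtr_ge0. Qed.

Lemma ipnorm_eq0 u : N u = 0 -> u = 0.
Proof. by move=> h; apply: (ip_eq0 hip); rewrite -sqr_ipnorm h expr0n. Qed.

Lemma cauchy_schwarz u v : `|ip u v| <= N u * N v.
Proof.
rewrite -ler_sqr ?nnegrE ?mulr_ge0 ?ipnorm_ge0 ?normr_ge0//.
rewrite real_normK ?num_real// exprMn !sqr_ipnorm.
apply: (@form_cauchy_schwarz _ _ ip setT) => //.
- exact: (ipC hip).
- exact: (ipL hip).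
- by move=> ? _; exact: (ip_ge0 hip).
Qed.

Lemma ipnormZ a u : N (a *: u) = `|a| * N u.
Proof.
rewrite /ipnorm !ipE mulrA -expr2 sqrtrM ?sqr_ge0//.
by rewrite sqrtr_sqr.
Qed.

Lemma ipnormN u : N (- u) = N u.
Proof. by rewrite -scaleN1r ipnormZ normrN1 mul1r. Qed.

Lemma ler_ipnormD u v : N (u + v) <= N u + N v.
Proof.
rewrite -ler_sqr ?nnegrE ?addr_ge0 ?ipnorm_ge0//.
rewrite sqr_ipnorm !ipE (ipC hip v u) sqrrD !sqr_ipnorm.
have := cauchy_schwarz u v; have := ler_norm (ip u v); lra.
Qed.

Lemma ler_ipnormB u v : N u - N v <= N (u - v).
Proof. by have := ler_ipnormD (u - v) v; rewrite subrK; lra. Qed.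

Record bounded_symmetric (T : V -> V) : Prop := {
  bs_lin : forall a u v, T (a *: u + v) = a *: T u + T v;
  bs_sym : forall u v, ip (T u) v = ip u (T v);
  bs_bound : exists2 b, 0 < b & forall u, N (T u) <= b * N u
}.

Section bounded_symmetric_theory.
Variable T : V -> V.
Hypothesis hT : bounded_symmetric T.

Lemma bs0 : T 0 = 0.
Proof.
have := bs_lin hT (-1) 0 0; rewrite scaler0 addr0 => ->.
by rewrite scaleN1r addNr.
Qed.

Lemma bsD u v : T (u + v) = T u + T v.
Proof. by have := bs_lin hT 1 u v; rewrite !scale1r. Qed.

Lemma bsZ a u : T (a *: u) = a *: T u.
Proof. by have := bs_lin hT a u 0; rewrite !addr0 bs0 addr0. Qed.

Lemma bsN u : T (- u) = - T u.
Proof. by rewrite -scaleN1r bsZ scaleN1r. Qed.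

Lemma bsB u v : T (u - v) = T u - T v.
Proof. by rewrite bsD bsN. Qed.

Lemma bs_shift c : bounded_symmetric (fun u => T u - c *: u).
Proof.
split.
- move=> a u v; rewrite (bs_lin hT) scalerBr scalerDr !scalerA (mulrC c).
  by rewrite opprD addrACA.
- by move=> u v; rewrite !ipE (bs_sym hT).
- have [b b0 Tb] := bs_bound hT; exists (b + `|c|) => [|u].
    by rewrite ltr_wpDr.
  rewrite (le_trans (ler_ipnormD _ _))// ipnormN ipnormZ mulrDl lerD2r.
  exact: Tb.
Qed.

Lemma bs_comp_self : bounded_symmetric (T \o T).
Proof.
split => /=.
- by move=> a u v; rewrite !(bs_lin hT).
- by move=> u v; rewrite !(bs_sym hT).
- have [b b0 Tb] := bs_bound hT; exists (b * b) => [|u].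
    by rewrite mulr_gt0.
  by rewrite (le_trans (Tb _))// -mulrA ler_pM2l.
Qed.

(** Cauchy-Schwarz for the form <T u, v> at u and T u gives |T u|^4 <= <T u, u> <T T u, T u> <= <T
    u, u> b |T u|^2; divide by |T u|^2. *)
Lemma psd_sqr_le (K : set V) b :
  (forall a u v, K u -> K v -> K (a *: u + v)) ->
  (forall u, K u -> K (T u)) -> (forall u, K u -> 0 <= ip (T u) u) ->
  0 < b -> (forall u, N (T u) <= b * N u) ->
  forall u, K u -> ip (T u) (T u) <= b * ip (T u) u.
Proof.
move=> KL KT T0 b0 Tb u Ku.
have TC v z : ip (T v) z = ip (T z) v by rewrite (bs_sym hT) (ipC hip).
have TL a v z t : ip (T (a *: v + z)) t = a * ip (T v) t + ip (T z) t.
  by rewrite (bs_lin hT) !ipE.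
have := form_cauchy_schwarz TC TL KL T0 Ku (KT _ Ku).
have [->|n0] := eqVneq (ip (T u) (T u)) 0.
  by rewrite mulr_ge0 ?T0// ltW.
have {}n0 : 0 < ip (T u) (T u) by rewrite lt_neqAle eq_sym n0 (ip_ge0 hip).
have le1 : ip (T (T u)) (T u) <= b * ip (T u) (T u).
  rewrite (le_trans (ler_norm _))// (le_trans (cauchy_schwarz _ _))//.
  by rewrite -(sqr_ipnorm (T u)) expr2 mulrA ler_wpM2r ?ipnorm_ge0.
move=> H; have := le_trans H (ler_wpM2l (T0 _ Ku) le1).
by rewrite expr2 mulrA ler_pM2r// mulrC.
Qed.

End bounded_symmetric_theory.

(** Being bounded below replaces invertibility: for a bounded symmetric operator on a Hilbert space,
    the points where [T - l] is not bounded below are exactly the spectrum. *)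
Definition approx_spectrum (T : V -> V) : set R :=
  [set l | ~ exists2 k, 0 < k & forall u, k * N u <= N (T u - l *: u)].

(** A lower bound [k] for [T - l] survives as [k / 2] for every [l'] within [k / 2] of [l]. *)
Lemma approx_spectrum_closed T l :
  (forall d, 0 < d -> exists2 l', approx_spectrum T l' & `|l' - l| < d) ->
  approx_spectrum T l.
Proof.
move=> H [k k0 Tk]; have [//|l' sl' dl'] := H (k / 2); first by rewrite divr_gt0.
apply: sl'; exists (k / 2) => [|u]; first by rewrite divr_gt0.
have -> : T u - l' *: u = (T u - l *: u) - (l' - l) *: u.
  by rewrite scalerBl opprB addrA subrK.
apply: le_trans (ler_ipnormB _ _); rewrite ipnormZ.
have := ler_wpM2r (ipnorm_ge0 u) (ltW dl'); have := Tk u.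
by rewrite [k in X in X -> _](splitr k) mulrDl; lra.
Qed.

(** Put Y = T - c and let t^2 be the infimum of |Y u|^2 on the unit sphere. If t < d, both Y - t and
    Y + t are bounded below, hence so is their product Z = Y^2 - t^2. But Z is nonnegative with <Z
    u, u> arbitrarily small on unit vectors, and [psd_sqr_le] makes |Z u| small along with it. *)
Lemma spectral_gap T c d : bounded_symmetric T -> 0 < d ->
  (forall l, approx_spectrum T l -> ~ (c - d < l < c + d)) ->
  forall u, d ^+ 2 * ip u u <= ip (T u - c *: u) (T u - c *: u).
Proof.
move=> hT d0 gap u0; rewrite leNgt; apply/negP => lt_u0.
have hY := bs_shift hT c; set Y := (fun u => T u - c *: u) in hY.
rewrite -/(Y u0) in lt_u0.
pose S := [set ip (Y u) (Y u) | u in [set u | ip u u = 1]].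
have u0n : 0 < ip u0 u0.
  by rewrite -(pmulr_rgt0 _ (exprn_gt0 2 d0)) (le_lt_trans (ip_ge0 hip _) lt_u0).
have [x0 Sx0 x0d] : exists2 x, S x & x < d ^+ 2.
  exists (ip (Y u0) (Y u0) / ip u0 u0); last by rewrite ltr_pdivrMr.
  exists ((N u0)^-1 *: u0) => /=.
    rewrite !ipE mulrA -expr2 exprVn sqr_ipnorm mulVf// gt_eqF//.
  by rewrite (bsZ hY) !ipE mulrA -expr2 exprVn sqr_ipnorm mulrC.
have S0 : lbound S 0 by move=> _ [u _ <-]; exact: ip_ge0.
have infS : has_inf S by split; [exists x0|exists 0].
have t0 : 0 <= inf S by apply: lb_le_inf => //; exists x0.
have td : inf S < d ^+ 2 by apply: le_lt_trans x0d; apply: ge_inf => //; exists 0.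
pose t := Num.sqrt (inf S).
have tt : t ^+ 2 = inf S by rewrite sqr_sqrtr.
have t_d : t < d.
  by rewrite -ltr_sqr ?nnegrE ?sqrtr_ge0 ?ltW// tt.
have t_ge0 : 0 <= t by exact: sqrtr_ge0.
have below e : `|e| < d -> exists2 k, 0 < k & forall u, k * N u <= N (Y u - e *: u).
  move=> ed; have /contrapT[k k0 Tk] : ~ approx_spectrum T (c + e).
    by move=> /gap; apply; move: ed; rewrite ltr_norml; lra.
  exists k => // u; rewrite (le_trans (Tk u))//.
  by rewrite /Y scalerDl opprD addrA.
have [k1 k10 b1] := below t ltac:(by rewrite ger0_norm).
have [k2 k20 b2] := below (- t) ltac:(by rewrite normrN ger0_norm).
have hZ := bs_shift (bs_comp_self hY) (inf S).
set Z := (fun u => _) in hZ.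
have ZE u : ip (Z u) u = ip (Y u) (Y u) - inf S * ip u u.
  by rewrite /Z (ipDl (_ (_ u))) ipNl ipZl /= (bs_sym hY).
have Z0 u : 0 <= ip (Z u) u.
  rewrite ZE subr_ge0; have [->|] := eqVneq (ip u u) 0.
    by rewrite mulr0 (ip_ge0 hip).
  rewrite neq_lt ltNge (ip_ge0 hip)/= => u_gt0.
  rewrite -ler_pdivlMr//; apply: ge_inf; first by exists 0.
  exists ((N u)^-1 *: u) => /=.
    by rewrite !ipE mulrA -expr2 exprVn sqr_ipnorm mulVf// gt_eqF.
  by rewrite (bsZ hY) !ipE mulrA -expr2 exprVn sqr_ipnorm mulrC.
have [bz bz0 Zb] := bs_bound hZ.
have Zle u := @psd_sqr_le _ hZ setT bz (fun _ _ _ _ _ => I) (fun _ _ => I)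
  (fun u _ => Z0 u) bz0 Zb u I.
have lowZ u : k2 * (k1 * N u) <= N (Z u).
  have -> : Z u = Y (Y u - t *: u) - (- t) *: (Y u - t *: u).
    rewrite (bsD hY) (bsN hY) (bsZ hY) scaleNr opprK (scalerBr t (Y u) (t *: u)).
    by rewrite addrA subrK scalerA -expr2 tt.
  by rewrite (le_trans _ (b2 _))// ler_pM2l.
(* Chosen so that a unit vector with <Z u, u> < e has |Z u|^2 <= bz <Z u, u> < (k2 k1)^2, against
   [lowZ]. *)
pose e := (k2 * k1) ^+ 2 / bz.
have e0 : 0 < e by rewrite divr_gt0// exprn_gt0// mulr_gt0.
have [_ [u /= u1 <-] ue] := inf_adherent e0 infS.
have := Zle u; rewrite -sqr_ipnorm ZE u1 mulr1.
have := lowZ u; rewrite /ipnorm u1 sqrtr1 mulr1 -/(ipnorm (Z u)) => low.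
have : (k2 * k1) ^+ 2 <= N (Z u) ^+ 2.
  by rewrite ler_sqr ?nnegrE ?ipnorm_ge0// mulr_ge0 ?ltW.
move=> le1 le2; have := le_trans le1 le2.
rewrite leNgt => /negP; apply.
by rewrite mulrC -ltr_pdivlMr// ltrBlDr addrC.
Qed.

End inner_product_theory.

Lemma le_geometric_eq0 (R : realType) (x C r : R) : 0 <= r < 1 ->
  (forall n, `|x| <= C * r ^+ n) -> x = 0.
Proof.
move=> /andP[r0 r1] H; apply/eqP; rewrite -normr_le0.
have : (fun n => C * r ^+ n) @ \oo --> C * 0.
  by apply: cvgMr; apply: cvg_expr; rewrite ger0_norm.
rewrite mulr0 => cv; rewrite -(cvg_lim _ cv)//.
apply: limr_ge; first by apply/cvg_ex; exists 0.
exact: nearW.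
Qed.

(** * Eigenvectors at isolated points of the spectrum, and singular sequences *)

Section discrete_spectrum.
Context {R : realType} {V : lmodType R} (ip : V -> V -> R).
Hypothesis hip : inner_product ip.
Local Notation N := (ipnorm ip).
Local Notation ipE := (ipE hip).

(** Completeness is asked for geometrically dominated series, with the geometric tail as error: the
    explicit rate lets identities pass to the limit through [le_geometric_eq0]. *)
Definition geometrically_complete :=
  forall (d : nat -> V) C q, 0 <= q < 1 -> (forall n, N (d n) <= C * q ^+ n) ->
  exists v, forall n, N (v - \sum_(i < n) d i) <= C * q ^+ n / (1 - q).

Hypothesis cip : geometrically_complete.
Variable T : V -> V.
Hypothesis hT : bounded_symmetric ip T.

Definition accumulation (l : R) := forall d, 0 < d ->
  exists2 l', approx_spectrum ip T l' & 0 < `|l' - l| < d.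

Lemma eigenvalue_approx_spectrum a e :
  ip e e = 1 -> T e = a *: e -> approx_spectrum ip T a.
Proof.
move=> e1 Te [k k0 /(_ e)]; rewrite Te subrr /ipnorm e1 sqrtr1 mulr1 !ipE.
by rewrite sqrtr0 leNgt k0.
Qed.

(** A gradient descent on the complement [K] of [s], which [T] preserves because [s] consists of
    eigenvectors: with [l] the infimum of the Rayleigh quotient on [K] and X = T - l, the steps u ->
    u - X u / b converge geometrically since [l] is isolated in the spectrum. *)
Lemma bottom_eigenvector (s : seq V) L :
  (forall e, e \in s -> exists a, T e = a *: e) ->
  (forall l, l <= L -> ~ accumulation l) ->
  (forall h, 0 < h -> exists u, [/\ forall e, e \in s -> ip u e = 0,
     ip u u = 1 & ip (T u) u < L + h]) ->
  exists e a, [/\ forall f, f \in s -> ip e f = 0, ip e e = 1,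
     T e = a *: e & a <= L].
Proof.
move=> Ts noacc small.
pose K := [set u | forall e, e \in s -> ip u e = 0].
have KL a u v : K u -> K v -> K (a *: u + v).
  by move=> Ku Kv e es; rewrite !ipE Ku// Kv// mulr0 addr0.
have K0 : K 0 by move=> e _; rewrite !ipE.
have KZ a u : K u -> K (a *: u).
  by move=> Ku; have := KL a u 0 Ku K0; rewrite addr0.
have KT u : K u -> K (T u).
  by move=> Ku e es; rewrite (bs_sym hT); have [a ->] := Ts _ es; rewrite !ipE Ku ?mulr0.
pose S := [set ip (T u) u | u in [set u | K u /\ ip u u = 1]].
have [b0 b0_gt0 Tb] := bs_bound hT.
have lS : lbound S (- b0).
  move=> _ [u [_ u1] <-]; have := cauchy_schwarz hip (T u) u.
  rewrite /ipnorm u1 sqrtr1 mulr1; have := Tb u.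
  rewrite /ipnorm u1 sqrtr1 mulr1 => h1 h2; have := le_trans h2 h1.
  by rewrite ler_norml => /andP[].
have S0 : S !=set0.
  by have [u [Ku u1 _]] := small 1 ltr01; exists (ip (T u) u), u.
have infS : has_inf S by split=> //; exists (- b0).
set l := inf S.
have lL : l <= L.
  apply/ler_addgt0Pr => h h0; have [u [Ku u1 Tu]] := small h h0.
  by rewrite (le_trans _ (ltW Tu))//; apply: ge_inf; [exists (- b0)|exists u].
have [d d0 dl] : exists2 d, 0 < d &
    forall l', approx_spectrum ip T l' -> ~ (0 < `|l' - l| < d).
  apply: contrapT => H; apply: (noacc l lL) => d d0; apply: contrapT => H'.
  by apply: H; exists d => // l' sl' hl'; apply: H'; exists l'.
have hX := bs_shift hip hT l.
set X := (fun u => _) in hX.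
have XE u : X u = T u - l *: u by [].
clearbody X.
(* There is no spectrum in (l, l + d), an interval centred at l + d / 2; expanding |X u - (d / 2)
   u|^2 >= (d / 2)^2 |u|^2 gives the claim. *)
have gapX u : d * ip (X u) u <= ip (X u) (X u).
  have gap l' : approx_spectrum ip T l' ->
      ~ (l + d / 2 - d / 2 < l' < l + d / 2 + d / 2).
    move=> /dl h h'; apply: h; apply/andP; split.
      by rewrite normr_gt0; lra.
    by rewrite ltr_norml; lra.
  have d2 : 0 < d / 2 by rewrite divr_gt0.
  have := spectral_gap hip hT d2 gap u.
  have -> : T u - (l + d / 2) *: u = X u - (d / 2) *: u.
    by rewrite XE scalerDl opprD addrA.
  rewrite !ipE (ipC hip u (X u)); lra.
have KX u : K u -> K (X u).
  by move=> Ku; rewrite XE addrC -scaleNr; apply: KL => //; exact: KT.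
have X0 u : K u -> 0 <= ip (X u) u.
  move=> Ku; rewrite XE !ipE subr_ge0.
  have [/(ip_eq0 hip)->|] := eqVneq (ip u u) 0.
    by rewrite (bs0 hT) !ipE mulr0.
  rewrite neq_lt ltNge (ip_ge0 hip)/= => u_gt0.
  rewrite -ler_pdivlMr//; apply: ge_inf; first by exists (- b0).
  exists ((N u)^-1 *: u) => /=.
    split; first exact: KZ.
    by rewrite !ipE mulrA -expr2 exprVn (sqr_ipnorm hip) mulVf// gt_eqF.
  by rewrite (bsZ hT) !ipE mulrA -expr2 exprVn (sqr_ipnorm hip) mulrC.
(* Cauchy-Schwarz for the form <X u, v> at u and X u: d |X u|^4 <= d <X u, u> <X X u, X u> <= |X
   u|^2 <X X u, X u>. *)
have gapXX u : K u -> d * ip (X u) (X u) <= ip (X (X u)) (X u).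
  move=> Ku.
  have XC v z : ip (X v) z = ip (X z) v by rewrite (bs_sym hX) (ipC hip).
  have XL a v z t : ip (X (a *: v + z)) t = a * ip (X v) t + ip (X z) t.
    by rewrite (bs_lin hX) !ipE.
  have := form_cauchy_schwarz XC XL KL X0 Ku (KX _ Ku).
  have [->|n0] := eqVneq (ip (X u) (X u)) 0.
    by rewrite mulr0 X0//; exact: KX.
  have {}n0 : 0 < ip (X u) (X u) by rewrite lt_neqAle eq_sym n0 (ip_ge0 hip).
  move=> CS; have := ler_wpM2r (X0 _ (KX _ Ku)) (gapX u).
  move=> le1; have := le_trans (ler_wpM2l (ltW d0) CS).
  rewrite mulrA => /(_ _ le1).
  by rewrite expr2 mulrCA ler_pM2l.
(* The bound is enlarged by [d] so that 1 - d / b, the square of the contraction rate, is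
   nonnegative. *)
have [b [b_gt0 db Xb]] : exists b, [/\ 0 < b, d <= b & forall u, N (X u) <= b * N u].
  have [b b1 Xb] := bs_bound hX; exists (b + d); split; first exact: addr_gt0.
    by rewrite lerDr ltW.
  move=> u; rewrite (le_trans (Xb u))// ler_wpM2r ?ipnorm_ge0// lerDl ltW//.
have XX := psd_sqr_le hip hX KL KX X0 b_gt0 Xb.
pose P u := u - b^-1 *: X u.
pose r := Num.sqrt (1 - d / b).
have r0 : 0 <= r by exact: sqrtr_ge0.
have db1 : 0 <= 1 - d / b by rewrite subr_ge0 ler_pdivrMr// mul1r.
have r1 : r < 1.
  rewrite -(@sqrtr1 R) ltr_sqrt// ltrBlDr ltrDl divr_gt0//.
(* With v = X u, |v - X v / b|^2 = |v|^2 - 2 <X v, v> / b + |X v|^2 / b^2 <= |v|^2 - <X v, v> / b <=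
   (1 - d / b) |v|^2. *)
have P_contr u : K u -> N (P (X u)) <= r * N (X u).
  move=> Ku; rewrite /ipnorm -sqrtrM// ler_sqrt ?mulr_ge0 ?(ip_ge0 hip)//.
  have h1 := gapXX u Ku; have h2 := XX _ (KX _ Ku).
  rewrite /P; set v := X u in h1 h2 *; rewrite !ipE (ipC hip v (X v)).
  have h3 : b^-1 * (b^-1 * ip (X v) (X v)) <= b^-1 * ip (X v) v.
    by rewrite ler_pM2l ?invr_gt0// mulrC ler_pdivrMr// mulrC.
  have h4 : d / b * ip v v <= b^-1 * ip (X v) v.
    by rewrite mulrAC mulrC ler_pM2l ?invr_gt0.
  lra.
(* A unit vector this close to the infimum has |X u|^2 <= b <X u, u> < b^2 (1 - r)^2, so the whole
   iteration moves it by less than 1 and the limit [w] is not 0. *)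
have eta0 : 0 < b * (1 - r) ^+ 2 by rewrite mulr_gt0// exprn_gt0// subr_gt0.
have [_ [u [Ku u1] <-] lu] := inf_adherent eta0 infS.
have KP n : K (iter n P u).
  elim: n => // n IH; rewrite iterS /P addrC -scaleNr.
  by apply: KL => //; exact: KX.
have XP v : X (P v) = P (X v).
  by rewrite /P (bsD hX) (bsN hX) (bsZ hX).
pose D n := X (iter n P u).
have DS n : D n.+1 = P (D n) by rewrite /D iterS XP.
have Dr n : N (D n) <= N (X u) * r ^+ n.
  elim: n => [|n IH]; first by rewrite mulr1.
  rewrite DS (le_trans (P_contr _ (KP n)))// exprS mulrCA ler_wpM2l//.
have [v hv] := cip (introT andP (conj r0 r1)) Dr.
(* The iterates of [P] at [u] are u minus 1 / b times the partial sums of [D]; [w] is their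
   limit. *)
pose w := u - b^-1 *: v.
have wE n : w = iter n P u - b^-1 *: (v - \sum_(i < n) D i).
  have -> : iter n P u = u - b^-1 *: \sum_(i < n) D i.
    elim: n => [|n IH]; first by rewrite big_ord0 scaler0 subr0.
    by rewrite iterS {1}/P -/(D n) {1}IH big_ord_recr/= scalerDr opprD addrA.
  by rewrite scalerBr opprB addrA subrK.
have Kw : K w.
  move=> e es; apply: (@le_geometric_eq0 _ _ (b^-1 * (N (X u) / (1 - r) * N e)) r).
    by rewrite r0.
  move=> n; rewrite (wE n); move: (v - _) (hv n) => z hz.
  rewrite !ipE (KP n _ es) add0r normrN normrM.
  rewrite gtr0_norm ?invr_gt0// -!mulrA ler_pM2l ?invr_gt0//.
  rewrite (le_trans (cauchy_schwarz hip _ _))//.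
  rewrite (le_trans (ler_wpM2r (ipnorm_ge0 ip _) hz))//.
  by rewrite le_eqVlt; apply/orP; left; apply/eqP; ring.
have Xw : X w = 0.
  apply: (ipnorm_eq0 hip).
  apply: (@le_geometric_eq0 _ _ (N (X u) + N (X u) / (1 - r)) r).
    by rewrite r0.
  move=> n; rewrite ger0_norm ?ipnorm_ge0// (wE n) (bsD hX) (bsN hX) (bsZ hX).
  rewrite (le_trans (ler_ipnormD hip _ _))// mulrDl lerD ?Dr//.
  rewrite (ipnormN hip) (ipnormZ hip) gtr0_norm ?invr_gt0//.
  move: (v - _) (hv n) => z hz.
  rewrite ler_pdivrMl// (le_trans (Xb _))// ler_pM2l// (le_trans hz)//.
  by rewrite mulrAC.
have w0 : 0 < N w.
  have /= := hv 0; rewrite big_ord0 subr0 expr0 mulr1 => Nv.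
  apply: lt_le_trans (ler_ipnormB hip _ _).
  rewrite (ipnormZ hip) gtr0_norm ?invr_gt0// /ipnorm u1 sqrtr1 subr_gt0.
  rewrite mulrC ltr_pdivrMr// mul1r (le_lt_trans Nv)//.
  rewrite ltr_pdivrMr ?subr_gt0//.
  rewrite -ltr_sqr ?nnegrE ?ipnorm_ge0 ?mulr_ge0 ?subr_ge0 ?(ltW r1) ?(ltW b_gt0)//.
  rewrite (sqr_ipnorm hip) (le_lt_trans (XX _ Ku))//.
  rewrite exprMn expr2 -mulrA ltr_pM2l// XE !ipE.
  by rewrite u1 mulr1 ltrBlDl.
clearbody w; exists ((N w)^-1 *: w), l; split => //.
- exact: KZ.
- by rewrite !ipE -(sqr_ipnorm hip); field; rewrite gt_eqF.
- rewrite (bsZ hT) scalerA mulrC -scalerA; congr (_ *: _).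
  by apply/eqP; rewrite -subr_eq0 -XE Xw.
Qed.

Definition orthonormal (s : seq V) :=
  pairwise (fun u v => ip u v == 0) s && all (fun u => ip u u == 1) s.

(* Asking for norms and Rayleigh quotients only in the limit makes the notion
   stable under projecting away an eigenvector. *)
Definition singular_sequence (L : R) (u : nat -> V) :=
  [/\ forall g, (fun j => ip (u j) g) @ \oo --> (0 : R),
      (fun j => ip (u j) (u j)) @ \oo --> (1 : R) &
      forall h, 0 < h -> \forall j \near \oo, ip (T (u j)) (u j) < L + h].

(** The component <u_j, e> tends to 0; removing it changes the squared norm by <u_j, e>^2 and the
    quadratic form by a <u_j, e>^2. *)
Lemma singular_sequence_project L u e a : ip e e = 1 -> T e = a *: e ->
  singular_sequence L u -> singular_sequence L (fun j => u j - ip (u j) e *: e).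
Proof.
move=> e1 Te [u0 u1 uL].
have c2 : (fun j => ip (u j) e ^+ 2) @ \oo --> (0 : R).
  have -> : (fun j => ip (u j) e ^+ 2) =
      (fun j => ip (u j) e) \* (fun j => ip (u j) e) by [].
  by rewrite -[X in _ --> X](mulr0 0); apply: cvgM; exact: u0.
split.
- move=> g.
  have -> : (fun j => ip (u j - ip (u j) e *: e) g) =
      (fun j => ip (u j) g - ip (u j) e * ip e g).
    by apply/funext => j; rewrite !ipE.
  rewrite -[X in _ --> X](subrr 0) -[X in _ --> _ - X](mul0r (ip e g)).
  by apply: cvgB => //; apply: cvgMl.
- have -> : (fun j => ip (u j - ip (u j) e *: e) (u j - ip (u j) e *: e)) =
      (fun j => ip (u j) (u j) - ip (u j) e ^+ 2).
    by apply/funext => j; move: (u j) => v; rewrite !ipE e1 (ipC hip e v); ring.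
  by rewrite -[X in _ --> X](subr0 1); exact: cvgB.
- move=> h h0.
  have h20 : 0 < h / 2 by rewrite divr_gt0.
  have /cvgrPdist_lt/(_ _ h20) H : (fun j => a * ip (u j) e ^+ 2) @ \oo --> (0 : R).
    by rewrite -[X in _ --> X](mulr0 a); apply: cvgMr.
  near=> j.
  have : `|0 - a * ip (u j) e ^+ 2| < h / 2 by near: j.
  have : ip (T (u j)) (u j) < L + h / 2 by near: j; exact: uL.
  move: (u j) => v.
  rewrite (bsB hT) (bsZ hT) Te !ipE e1 (bs_sym hT v e) Te !ipE (ipC hip e v).
  by rewrite sub0r normrN ltr_norml => ? /andP[? _]; lra.
Unshelve. all: by end_near. Qed.

(** For a unit eigenvector the eigenvalue is <T e, e>, so the family need not carry its eigenvalues
    along. *)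
Definition eigenfamily (t : R) (s : seq V) := orthonormal s /\
  forall e, e \in s -> T e = ip (T e) e *: e /\ ip (T e) e <= t.

(** Induction on [n], carrying a singular sequence orthogonal to the eigenvectors found so far: it
    supplies the trial vectors for [bottom_eigenvector] and is then projected off the new
    eigenvector. *)
Lemma eigenfamily_of_singular_sequence L v : singular_sequence L v ->
  (forall l, l <= L -> ~ accumulation l) ->
  forall n, exists2 s, size s = n & eigenfamily L s.
Proof.
move=> vL noacc n.
suff [s [u [sn sL _ _]]] : exists s u, [/\ size s = n, eigenfamily L s,
    singular_sequence L u & forall j e, e \in s -> ip (u j) e = 0].
  by exists s.
elim: n => [|n [s [u [sn [/andP[os ns] sL] uL us]]]].
  by exists [::], v; split.
have Ts e : e \in s -> exists a, T e = a *: e.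
  by move=> /sL[Te _]; exists (ip (T e) e).
have [|e [a [es e1 Te aL]]] := bottom_eigenvector Ts noacc.
  move=> h h0; have [_ u1 {}uL] := uL.
  have h20 : 0 < h / 2 by rewrite divr_gt0.
  (* The norms are only nearly 1, so half of [h] is spent on normalization: <T u, u> < L + h / 2 <
     (L + h) |u|^2 for large [j]. *)
  have H1 : \forall j \near \oo, 0 < ip (u j) (u j).
    by apply: (cvgr_gt 1) => //.
  have H2 : \forall j \near \oo, L + h / 2 < (L + h) * ip (u j) (u j).
    apply: (cvgr_gt (L + h)); last by lra.
    by rewrite -[X in _ --> X]mulr1; apply: cvgMr.
  have [j [uj0 ujh ujL]] : exists j, [/\ 0 < ip (u j) (u j),
      L + h / 2 < (L + h) * ip (u j) (u j) & ip (T (u j)) (u j) < L + h / 2].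
    have [j] : exists j, 0 < ip (u j) (u j) /\
        (L + h / 2 < (L + h) * ip (u j) (u j) /\
         ip (T (u j)) (u j) < L + h / 2).
      near \oo => j; exists j; split; [by near: j|split; near: j => //].
      exact: uL.
    by case=> ? [? ?]; exists j.
  have N2 := sqr_ipnorm hip (u j).
  have N0 : 0 < N (u j).
    by rewrite lt_neqAle ipnorm_ge0 andbT eq_sym; apply: contraTneq uj0 => N0;
      rewrite -N2 N0 expr0n ltxx.
  exists ((N (u j))^-1 *: u j); split.
  - by move=> e es; rewrite !ipE us// mulr0.
  - by rewrite !ipE -N2; field; rewrite gt_eqF.
  - rewrite (bsZ hT) !ipE mulrA -expr2 exprVn N2 mulrC ltr_pdivrMr//; lra.
exists (e :: s), (fun j => u j - ip (u j) e *: e).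
have Tee : ip (T e) e = a by rewrite Te !ipE e1 mulr1.
split; first by rewrite /= sn.
- split.
    rewrite /orthonormal /= os ns e1 eqxx !andbT.
    by apply/allP => f fs; rewrite es.
  by move=> f; rewrite inE => /predU1P[->|/sL//]; rewrite Tee.
- exact: singular_sequence_project Te uL.
- move=> j f; rewrite inE !ipE => /predU1P[->|fs]; first by rewrite e1 mulr1 subrr.
  by rewrite us// es// mulr0 subrr.
Unshelve. all: by end_near. Qed.

Lemma eigenfamily_subseq t s s' : subseq s' s -> eigenfamily t s ->
  eigenfamily t s'.
Proof.
move=> ss [/andP[os ns] sL]; split.
  rewrite /orthonormal (subseq_pairwise ss os)/=.
  by apply/allP => e /(mem_subseq ss); exact: (allP ns).
by move=> e /(mem_subseq ss); exact: sL.
Qed.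

(** Without accumulation up to [L], let [l] be the infimum of the levels below which eigenfamilies
    are arbitrarily long. No other spectrum is near [l], and eigenfamilies at level l - d / 2 have
    bounded length, so arbitrarily many eigenvectors have eigenvalue exactly [l]. *)
Lemma essential_spectrum_of_singular_sequence L v : singular_sequence L v ->
  exists2 l, l <= L & approx_spectrum ip T l /\ (accumulation l \/
    forall n, exists s, [/\ size s = n, orthonormal s &
      forall e, e \in s -> T e = l *: e]).
Proof.
move=> vL; have [[l lL al]|noacc] := pselect (exists2 l, l <= L & accumulation l).
  exists l => //; split; last by left.
  apply: (approx_spectrum_closed hip) => d /al[l' sl' /andP[_ hl']].
  by exists l'.
have {}noacc l : l <= L -> ~ accumulation l by move=> lL al; apply: noacc; exists l.
have fam := eigenfamily_of_singular_sequence vL noacc.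
pose S := [set t | forall n, exists2 s, size s = n & eigenfamily t s].
have SL : S L by [].
have [b b0 Tb] := bs_bound hT.
have lS : lbound S (- b).
  move=> t /(_ 1)[[|e [|//]]//= _ [/andP[_ /=]]].
  rewrite andbT => /eqP e1 /(_ e (mem_head _ _))[Te]; apply: le_trans.
  have := cauchy_schwarz hip (T e) e; have := Tb e.
  rewrite /ipnorm e1 sqrtr1 !mulr1 => h1 h2; have := le_trans h2 h1.
  by rewrite ler_norml => /andP[].
have infS : has_inf S by split; [exists L|exists (- b)].
set l := inf S.
have lL : l <= L by apply: ge_inf => //; exists (- b).
have [d d0 dl] : exists2 d, 0 < d &
    forall l', approx_spectrum ip T l' -> ~ (0 < `|l' - l| < d).
  apply: contrapT => H; apply: (noacc l lL) => d d0; apply: contrapT => H'.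
  by apply: H; exists d => // l' sl' hl'; apply: H'; exists l'.
have d20 : 0 < d / 2 by rewrite divr_gt0.
have [n0 nfam] : exists n0, ~ exists2 s, size s = n0 & eigenfamily (l - d / 2) s.
  apply/existsNP => Sd; have : l <= l - d / 2 by apply: ge_inf => //; exists (- b).
  lra.
have main n : exists s, [/\ size s = n, orthonormal s &
      forall e, e \in s -> T e = l *: e].
  have [t St tl] := inf_adherent d20 infS.
  (* Fewer than [n0] of these eigenvectors have eigenvalue at most l - d / 2; at least [n] remain,
     with eigenvalues within d / 2 of [l], hence equal to it. *)
  have [s sn sL] := St (n + n0)%N.
  pose low e := ip (T e) e <= l - d / 2.
  have size_low : (size (seq.filter low s) < n0)%N.
    rewrite ltnNge; apply/negP => le; apply: nfam.
    exists (take n0 (seq.filter low s)); first by rewrite size_takel.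
    have [os sL'] := eigenfamily_subseq
      (subseq_trans (take_subseq _ n0) (filter_subseq low s)) sL.
    split=> // e es; have [Te _] := sL' e es; split=> //.
    by move: (mem_take es); rewrite mem_filter => /andP[].
  have := count_predC low s; rewrite -!size_filter sn => szE.
  have size_high : (n <= size (seq.filter (predC low) s))%N.
    by rewrite -(leq_add2l (size (seq.filter low s))) szE addnC leq_add2l ltnW.
  exists (take n (seq.filter (predC low) s)).
  have [os sL'] := eigenfamily_subseq
      (subseq_trans (take_subseq _ n) (filter_subseq (predC low) s)) sL.
  split => //; first by rewrite size_takel.
  move=> e es; have [Te let_] := sL' e es; rewrite Te; congr (_ *: _).
  have e1 : ip e e = 1 by apply/eqP; case/andP: os => _ /allP; exact.
  have := dl _ (eigenvalue_approx_spectrum e1 Te) => nd.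
  apply/eqP; rewrite -subr_eq0; apply/negP => /negP ne; apply: nd.
  rewrite normr_gt0 ne/= ltr_norml.
  move: (mem_take es); rewrite mem_filter /= /low -ltNge => /andP[lo _].
  by apply/andP; split; lra.
exists l => //; split; last by right.
have [[|e s] [//_ /andP[_ /= /andP[/eqP e1 _]]]] := main 1.
move=> /(_ e (mem_head _ _)).
exact: eigenvalue_approx_spectrum.
Qed.

End discrete_spectrum.

(** * The space l2(theta) *)

Section summation.
Context {R : realType} {G : choiceType}.
Implicit Types (h g a b : G -> R).

(** [fine] sends +oo to 0, so this is meaningful for nonnegative families that are [summ]. *)
Definition nsum h : R := fine (\esum_(x in [set: G]) (h x)%:E).

Definition summ h : Prop := (\esum_(x in [set: G]) `|h x|%:E < +oo)%E.

(** A signed sum as a difference of two sums with nonnegative terms; by [rsumB] any other such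
    splitting into summable families gives the same value. *)
Definition rsum h : R := nsum (fun x => `|h x| + h x) - nsum (fun x => `|h x|).

Lemma summ_le h g : (forall x, `|g x| <= `|h x|) -> summ h -> summ g.
Proof.
move=> gh; apply: le_lt_trans; by apply: le_esum => x _; rewrite lee_fin.
Qed.

Lemma summD h g : summ h -> summ g -> summ (fun x => h x + g x).
Proof.
move=> sh sg; apply: le_lt_trans (lte_add_pinfty sh sg).
rewrite -esumD; try by move=> x _; rewrite lee_fin.
by apply: le_esum => x _; rewrite -EFinD lee_fin ler_normD.
Qed.

Lemma summ_norm h : summ h -> summ (fun x => `|h x|).
Proof. by apply: summ_le => x; rewrite normr_id. Qed.

Lemma nsumE h : (forall x, 0 <= h x) -> summ h ->
  (nsum h)%:E = (\esum_(x in [set: G]) (h x)%:E)%E.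
Proof.
move=> h0 sh; rewrite /nsum fineK// ge0_fin_numE; last first.
  by apply: esum_ge0 => x _; rewrite lee_fin.
apply: le_lt_trans sh; by apply: le_esum => x _; rewrite lee_fin ler_norm.
Qed.

Lemma nsumD a b : (forall x, 0 <= a x) -> (forall x, 0 <= b x) ->
  summ a -> summ b -> nsum (fun x => a x + b x) = nsum a + nsum b.
Proof.
move=> a0 b0 sa sb; apply: EFin_inj.
rewrite nsumE//; [|by move=> x; rewrite addr_ge0|exact: summD].
by rewrite EFinD !nsumE// -esumD// => x _; rewrite lee_fin.
Qed.

Lemma nsum_le a b : (forall x, 0 <= a x <= b x) -> summ b -> nsum a <= nsum b.
Proof.
move=> ab sb.
have a0 x : 0 <= a x by case/andP: (ab x).
have b0 x : 0 <= b x by rewrite (le_trans (a0 x))//; case/andP: (ab x).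
rewrite -lee_fin !nsumE//.
  by apply: le_esum => x _; rewrite lee_fin; case/andP: (ab x).
by apply: summ_le sb => x; rewrite !ger0_norm//; case/andP: (ab x).
Qed.

Lemma nsum_ge0 a : (forall x, 0 <= a x) -> 0 <= nsum a.
Proof. by move=> a0; apply: fine_ge0; apply: esum_ge0 => x _; rewrite lee_fin. Qed.

Lemma fin_sum_le_nsum a (F : seq G) : (forall x, 0 <= a x) -> summ a -> uniq F ->
  \sum_(x <- F) a x <= nsum a.
Proof.
move=> a0 sa uF; rewrite -lee_fin nsumE// -sumEFin.
apply: esum_ge; exists [set` F]; first by split.
by rewrite fsbig_seq.
Qed.

Lemma nsum_le_fin_sum a C : (forall x, 0 <= a x) ->
  (forall F : seq G, uniq F -> \sum_(x <- F) a x <= C) ->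
  summ a /\ nsum a <= C.
Proof.
move=> a0 aC.
have le : (\esum_(x in [set: G]) (a x)%:E <= C%:E)%E.
  apply: ub_ereal_sup => _ [F [finF _] <-].
  by rewrite fsbig_finite// sumEFin lee_fin; apply: aC; exact: finmap.fset_uniq.
have sa : summ a.
  rewrite /summ (@eq_esum _ _ _ _ (EFin \o a)) => [|x _]; last by rewrite /= ger0_norm.
  by rewrite (le_lt_trans le)// ltry.
by split=> //; rewrite -lee_fin nsumE.
Qed.

Lemma summZ c h : summ h -> summ (fun x => c * h x).
Proof.
move=> sh.
have := @nsum_le_fin_sum (fun x => `|c * h x|) (`|c| * nsum (fun x => `|h x|)).
case=> // [F uF|+ _].
  under eq_bigr do rewrite normrM.
  rewrite -mulr_sumr ler_wpM2l//.
  by apply: fin_sum_le_nsum => //; exact: summ_norm.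
by apply: summ_le => x; rewrite normr_id.
Qed.

Lemma nsumZ c a : 0 <= c -> (forall x, 0 <= a x) -> summ a ->
  nsum (fun x => c * a x) = c * nsum a.
Proof.
(* One inequality for all constants is enough: the other is its instance for [c^-1] and the family
   [c * a]. *)
have le c' a' : 0 <= c' -> (forall x, 0 <= a' x) -> summ a' ->
    nsum (fun x => c' * a' x) <= c' * nsum a'.
  move=> c0 a0 sa; apply nsum_le_fin_sum; first by move=> x; rewrite mulr_ge0.
  move=> F uF; rewrite -mulr_sumr ler_wpM2l//.
  exact: fin_sum_le_nsum.
rewrite le_eqVlt => /predU1P[<-|c0] a0 sa.
  rewrite mul0r; apply/eqP; rewrite eq_le nsum_ge0 ?andbT.
    by rewrite -[leRHS](mul0r (nsum a)) le.
  by move=> x; rewrite mul0r.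
apply/eqP; rewrite eq_le; apply/andP; split; first by apply: le => //; exact: ltW.
rewrite -ler_pdivlMl//.
have := le c^-1 (fun x => c * a x).
rewrite invr_ge0 ltW// => /(_ isT)/(_ (fun x => mulr_ge0 (ltW c0) (a0 x)) (summZ c sa)).
apply: le_trans; rewrite le_eqVlt; apply/orP; left; apply/eqP; congr nsum.
by apply/funext => x; rewrite mulrA mulVf ?mul1r// gt_eqF.
Qed.

Lemma rsumB a b : (forall x, 0 <= a x) -> (forall x, 0 <= b x) ->
  summ a -> summ b -> rsum (fun x => a x - b x) = nsum a - nsum b.
Proof.
move=> a0 b0 sa sb.
have sab : summ (fun x => a x - b x).
  have := summD sa (summZ (-1) sb); apply: summ_le => x.
  by rewrite mulN1r.
have sn := summ_norm sab.
apply/eqP; rewrite /rsum subr_eq addrAC eq_sym subr_eq eq_sym; apply/eqP.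
rewrite -!nsumD//.
- by congr nsum; apply/funext => x; ring.
- by move=> x; rewrite -lerBlDr sub0r (le_trans (ler_norm _))// normrN.
- exact: summD.
Qed.

Lemma rsum_nsum a : (forall x, 0 <= a x) -> summ a -> rsum a = nsum a.
Proof.
move=> a0 sa.
have z0 : nsum (fun=> 0) = 0 by rewrite /nsum esum1.
have sz : summ (fun=> 0) by apply: summ_le sa => x; rewrite normr0.
rewrite -[RHS]subr0 -z0 -rsumB//.
by congr rsum; apply/funext => x; rewrite subr0.
Qed.

Let addn_ge0 h x : 0 <= `|h x| + h x.
Proof. by rewrite -lerBlDr sub0r (le_trans (ler_norm _))// normrN. Qed.

Lemma rsumD h g : summ h -> summ g ->
  rsum (fun x => h x + g x) = rsum h + rsum g.
Proof.
move=> sh sg; have [nh ng] := (summ_norm sh, summ_norm sg).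
have -> : (fun x => h x + g x) = (fun x =>
   ((`|h x| + h x) + (`|g x| + g x)) - (`|h x| + `|g x|)).
  by apply/funext => x; ring.
rewrite rsumB.
- rewrite (nsumD (addn_ge0 h) (addn_ge0 g)); [|exact: summD|exact: summD].
  by rewrite (nsumD (fun x => normr_ge0 (h x)) (fun x => normr_ge0 (g x)))// /rsum; ring.
- by move=> x; rewrite addr_ge0.
- by move=> x; rewrite addr_ge0.
- by apply: summD; exact: summD.
- exact: summD.
Qed.

Lemma rsumZ c h : summ h -> rsum (fun x => c * h x) = c * rsum h.
Proof.
move=> sh; have nh := summ_norm sh; have nhh := summD nh sh.
have [c0|c0] := leP 0 c.
  have -> : (fun x => c * h x) = (fun x => c * (`|h x| + h x) - c * `|h x|).
    by apply/funext => x; ring.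
  rewrite rsumB ?nsumZ// -?mulrBr//.
  + by move=> x; rewrite mulr_ge0.
  + by move=> x; rewrite mulr_ge0.
  + exact: summZ.
  + exact: summZ.
have {}c0 : 0 <= - c by rewrite oppr_ge0 ltW.
have -> : (fun x => c * h x) = (fun x => - c * `|h x| - (- c) * (`|h x| + h x)).
  by apply/funext => x; ring.
rewrite rsumB ?nsumZ//; first by rewrite /rsum; ring.
+ by move=> x; rewrite mulr_ge0.
+ by move=> x; rewrite mulr_ge0.
+ exact: summZ.
+ exact: summZ.
Qed.

End summation.

Section l2_space.
Context {R : realType} {G : countType}.
Variable theta : G -> R.
Hypothesis theta_gt0 : forall x, 0 < theta x.
Implicit Types f g : G -> R^o.

Lemma L2_summ f : L2 theta f <-> summ (fun x => f x ^+ 2 * theta x).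
Proof.
rewrite /L2 /normsqL2 /summ /=; split; congr (_ < _)%E; apply: eq_esum => x _;
  by rewrite ger0_norm// mulr_ge0 ?sqr_ge0// ltW.
Qed.

Lemma L2_submod (a : R) f g : L2 theta f -> L2 theta g -> L2 theta (a *: f + g).
Proof.
move=> /L2_summ sf /L2_summ sg; apply/L2_summ.
apply: summ_le (summD (summZ (2 * a ^+ 2) sf) (summZ 2 sg)) => x.
have le (p q t : R) : 0 < t -> `|(a * p + q) ^+ 2 * t| <=
    `|2 * a ^+ 2 * (p ^+ 2 * t) + 2 * (q ^+ 2 * t)|.
  move=> t0; rewrite ger0_norm; last by rewrite pmulr_lge0// sqr_ge0.
  apply: le_trans (ler_norm _).
  have -> : 2 * a ^+ 2 * (p ^+ 2 * t) + 2 * (q ^+ 2 * t) =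
    (2 * a ^+ 2 * p ^+ 2 + 2 * q ^+ 2) * t by ring.
  by rewrite ler_pM2r//; have := sqr_ge0 (a * p - q); nra.
exact: le.
Qed.

Lemma L2_mul_summ f g : L2 theta f -> L2 theta g ->
  summ (fun x => f x * g x * theta x).
Proof.
move=> /L2_summ sf /L2_summ sg; apply: summ_le (summD sf sg) => x.
have t0 := ltW (theta_gt0 x).
rewrite [leRHS]ger0_norm; last by rewrite addr_ge0// mulr_ge0// sqr_ge0.
rewrite -mulrDl normrM (ger0_norm t0) ler_wpM2r// ler_norml.
have := sqr_ge0 (f x - g x); have := sqr_ge0 (f x + g x).
by move=> h1 h2; apply/andP; split; nra.
Qed.

(** The proof of positivity is an index, so that the submodule instance, which relies on it, can
    recover it from the type. *)
Definition l2_pred (_ : forall x, 0 < theta x) : {pred G -> R^o} :=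
  fun f => `[< L2 theta f >].

Lemma l2_submod_closed : submod_closed (l2_pred theta_gt0).
Proof.
split.
  apply/asboolP/L2_summ; rewrite /summ esum1 ?ltry// => x _.
  by rewrite expr0n mul0r normr0.
move=> a f g /asboolP Lf /asboolP Lg; apply/asboolP; exact: L2_submod.
Qed.

HB.instance Definition _ :=
  GRing.isSubmodClosed.Build R (G -> R^o) (l2_pred theta_gt0) l2_submod_closed.

Record l2 (h : forall x, 0 < theta x) :=
  L2Fun { l2_fun :> G -> R^o; _ : l2_fun \in l2_pred h }.

End l2_space.

HB.instance Definition _ (R : realType) (G : countType) (theta : G -> R) h :=
  [isSub for @l2_fun R G theta h].
HB.instance Definition _ (R : realType) (G : countType) (theta : G -> R) h :=
  [Choice of @l2 R G theta h by <:].
HB.instance Definition _ (R : realType) (G : countType) (theta : G -> R) h :=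
  [SubChoice_isSubLmodule of @l2 R G theta h by <:].

Section l2_theory.
Context {R : realType} {G : countType} {theta : G -> R}.
Context {theta_gt0 : forall x, 0 < theta x}.
Local Notation l2 := (l2 theta_gt0).
Implicit Types f g : l2.

Lemma l2_L2 f : L2 theta f.
Proof. by case: f => f /= /asboolP. Qed.

Lemma l2_summ f : summ (fun x => f x ^+ 2 * theta x).
Proof. exact: (proj1 (L2_summ theta_gt0 f) (l2_L2 f)). Qed.

Lemma l2_term_ge0 f x : 0 <= f x ^+ 2 * theta x.
Proof. by rewrite mulr_ge0 ?sqr_ge0 ?ltW. Qed.

Definition l2_of (f : G -> R^o) (Lf : L2 theta f) : l2 :=
  @L2Fun _ _ _ theta_gt0 f (asboolT Lf).

Lemma l2E a f g x : l2_fun (a *: f + g) x = a * f x + g x.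
Proof. by []. Qed.

Lemma l2_ext f g : (forall x, f x = g x) -> f = g.
Proof. by move=> fg; apply: val_inj; apply/funext. Qed.

Definition l2_ip f g : R := rsum (fun x => f x * g x * theta x).

Lemma l2_ip_nsum f : l2_ip f f = nsum (fun x => f x ^+ 2 * theta x).
Proof.
rewrite /l2_ip -rsum_nsum.
- by congr rsum; apply/funext => x; rewrite expr2.
- by move=> x; rewrite mulr_ge0 ?sqr_ge0 ?ltW.
- exact: l2_summ.
Qed.

Lemma l2_inner_product : inner_product l2_ip.
Proof.
split.
- by move=> f g; congr rsum; apply/funext => x; rewrite (mulrC (f x)).
- move=> a f g h.
  have sf := L2_mul_summ theta_gt0 (l2_L2 f) (l2_L2 h).
  have sg := L2_mul_summ theta_gt0 (l2_L2 g) (l2_L2 h).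
  rewrite /l2_ip -rsumZ// -rsumD//; last exact: summZ.
  by congr rsum; apply/funext => x; rewrite l2E; ring.
- move=> f; rewrite l2_ip_nsum; apply: nsum_ge0 => x.
  by rewrite mulr_ge0 ?sqr_ge0 ?ltW.
- move=> f; rewrite l2_ip_nsum => f0; apply: l2_ext => x; apply/eqP.
  have := @fin_sum_le_nsum _ _ (fun x => f x ^+ 2 * theta x) [:: x].
  rewrite big_seq1 f0 => /(_ _ _ isT) le.
  have : f x ^+ 2 * theta x <= 0.
    by apply: le; [exact: l2_term_ge0|exact: l2_summ].
  by rewrite pmulr_lle0// real_exprn_even_le0// num_real.
Qed.

Lemma l2_sqr_le f (F : seq G) : uniq F ->
  \sum_(x <- F) f x ^+ 2 * theta x <= l2_ip f f.
Proof.
move=> uF; rewrite l2_ip_nsum.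
apply: (@fin_sum_le_nsum _ _ (fun x => f x ^+ 2 * theta x)) => //.
  by move=> x; rewrite mulr_ge0 ?sqr_ge0 ?ltW.
exact: l2_summ.
Qed.

Lemma l2_eval_le f x : `|f x| <= (Num.sqrt (theta x))^-1 * ipnorm l2_ip f.
Proof.
have tx := theta_gt0 x; have sx : 0 < Num.sqrt (theta x) by rewrite sqrtr_gt0.
rewrite ler_pdivlMl// -ler_sqr ?nnegrE ?mulr_ge0 ?sqrtr_ge0//.
rewrite exprMn (sqr_sqrtr (ltW tx)) (sqr_ipnorm l2_inner_product).
rewrite real_normK ?num_real//.
have := @l2_sqr_le f [:: x] isT; rewrite big_seq1. by rewrite mulrC.
Qed.

Lemma cvgn_seq_sum (I : Type) (r : seq I) (u : I -> nat -> R) (l : I -> R) :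
  (forall i, u i @ \oo --> l i) ->
  (fun n => \sum_(i <- r) u i n) @ \oo --> \sum_(i <- r) l i.
Proof.
move=> ul; elim: r => [|i r IH].
  by under eq_fun do rewrite big_nil; rewrite big_nil; exact: cvg_cst.
under eq_fun do rewrite big_cons; rewrite big_cons.
exact: cvgD (ul i) IH.
Qed.

Lemma l2_sumE (I : Type) (r : seq I) (P : pred I) (F : I -> l2) x :
  (\sum_(i <- r | P i) F i) x = \sum_(i <- r | P i) F i x.
Proof. by elim/big_rec2: _ => // i y g _ <-. Qed.

Lemma l2_le_of_fin (f : G -> R^o) C :
  (forall F : seq G, uniq F -> \sum_(x <- F) f x ^+ 2 * theta x <= C) ->
  exists2 g : l2, (forall x, g x = f x) & l2_ip g g <= C.
Proof.
move=> fC; have f0 x : 0 <= f x ^+ 2 * theta x by rewrite mulr_ge0 ?sqr_ge0 ?ltW.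
have [sf le] := nsum_le_fin_sum f0 fC.
exists (l2_of (proj2 (L2_summ theta_gt0 f) sf)) => //.
by rewrite l2_ip_nsum.
Qed.

(** The sum [v] is taken pointwise, using continuity of evaluation. The geometric bound on S (n + k)
    - S n holds over each finite set, hence for v - S n on letting [k] grow, and then for the full
    norm, a supremum over finite sets. *)
Lemma l2_complete : geometrically_complete l2_ip.
Proof.
move=> d C q /andP[q0 q1] dC.
have hip := @l2_inner_product.
have C0 : 0 <= C by have := le_trans (ipnorm_ge0 l2_ip _) (dC 0); rewrite mulr1.
pose S n := \sum_(i < n) d i.
have SE n x : S n x = series (fun i => d i x) n.
  by rewrite /S l2_sumE /series /= big_mkord.
have cvS x : cvgn (series (fun i => d i x)).
  apply: normed_cvg.
  apply: (@series_le_cvg _ _ (geometric ((Num.sqrt (theta x))^-1 * C) q)).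
  - by move=> n; exact: normr_ge0.
  - by move=> n; rewrite /geometric/= !mulr_ge0 ?invr_ge0 ?sqrtr_ge0 ?exprn_ge0.
  - move=> n; rewrite /geometric/= (le_trans (l2_eval_le _ _))// -mulrA.
    by rewrite ler_wpM2l ?invr_ge0 ?sqrtr_ge0.
  - by apply: is_cvg_geometric_series; rewrite ger0_norm.
pose v x := limn (series (fun i => d i x)).
have norm_diff n k : ipnorm l2_ip (S (n + k)%N - S n) <= C * q ^+ n / (1 - q).
  have -> : S (n + k)%N - S n = \sum_(i < k) d (n + i)%N.
    by rewrite /S big_split_ord/= addrAC subrr add0r.
  have le : ipnorm l2_ip (\sum_(i < k) d (n + i)%N) <= \sum_(i < k) C * q ^+ (n + i).
    elim: k => [|k IH]; first by rewrite !big_ord0 /ipnorm (ipE hip) sqrtr0.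
    rewrite !big_ord_recr/= (le_trans (ler_ipnormD hip _ _))// lerD//.
  rewrite (le_trans le)//.
  under eq_bigr do rewrite exprD mulrA.
  rewrite -mulr_sumr ler_wpM2l ?mulr_ge0 ?exprn_ge0//.
  have := subrX1 q k; set s := \sum_(i < k) _ => sq.
  rewrite -[leRHS]mul1r ler_pdivlMr ?subr_gt0//.
  have := exprn_ge0 k q0; lra.
have tail n (F : seq G) : uniq F ->
    \sum_(x <- F) (v x - S n x) ^+ 2 * theta x <= (C * q ^+ n / (1 - q)) ^+ 2.
  move=> uF.
  have cv : (fun k => \sum_(x <- F) (S (n + k)%N x - S n x) ^+ 2 * theta x) @ \oo -->
     \sum_(x <- F) (v x - S n x) ^+ 2 * theta x.
    apply: cvgn_seq_sum => x; apply: cvgMl.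
    have cvk : (fun k => S (n + k)%N x - S n x) @ \oo --> v x - S n x.
      apply: cvgB; last exact: cvg_cst.
      have -> : (fun k => l2_fun (S (n + k)%N) x) =
          (fun k => series (fun i => d i x) (k + n)%N).
        by apply/funext => k; rewrite SE addnC.
      by rewrite (@cvg_shiftn n); exact: cvS.
    under eq_fun do rewrite expr2; rewrite expr2; exact: cvgM.
  rewrite -(cvg_lim _ cv)//; apply: limr_le; first by apply/cvg_ex; eexists; exact: cv.
  apply: nearW => k.
  rewrite (le_trans (l2_sqr_le (S (n + k)%N - S n) uF))//.
  rewrite -(sqr_ipnorm hip) ler_sqr ?nnegrE ?ipnorm_ge0//.
  by rewrite !mulr_ge0 ?exprn_ge0// invr_ge0 subr_ge0 ltW.
(* The tail at n = 0, where the partial sum is empty, puts [v] itself in l2. *)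
have [g gv _] : exists2 g : l2, (forall x, g x = v x) &
    l2_ip g g <= (C * q ^+ 0 / (1 - q)) ^+ 2.
  apply: l2_le_of_fin => F uF; apply: le_trans (tail 0 F uF).
  rewrite le_eqVlt; apply/orP; left; apply/eqP; apply: eq_bigr => x _.
  by rewrite /S big_ord0 subr0.
exists g => n.
rewrite -ler_sqr ?nnegrE ?ipnorm_ge0 ?mulr_ge0 ?exprn_ge0//; last first.
  by rewrite invr_ge0 subr_ge0 ltW.
have [h hE hC] := l2_le_of_fin (tail n).
rewrite (sqr_ipnorm hip) (le_trans _ hC)//.
have -> : g - \sum_(i < n) d i = h by apply: l2_ext => x; rewrite hE -gv.
by [].
Qed.

Lemma rsum_at (x : G) (c : R) : rsum (fun y => (y == x)%:R * c) = c.
Proof.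
have e0 y : 0 <= (y == x)%:R :> R by rewrite ler0n.
have E : (\esum_(y in [set: G]) ((y == x)%:R : R)%:E = 1)%E.
  transitivity (\esum_(y in [set x]) (1 : \bar R))%E; last by rewrite esum_set1.
  rewrite [RHS]esum_mkcond; apply: eq_esum => y _.
  rewrite (_ : (y \in [set x]) = (y == x)); last by apply/idP/eqP; rewrite inE.
  by case: eqP.
have s : summ (fun y => (y == x)%:R : R).
  rewrite /summ; under eq_esum do rewrite ger0_norm//.
  by rewrite E ltry.
under [X in rsum X]eq_fun do rewrite mulrC.
by rewrite rsumZ// rsum_nsum// /nsum E mulr1.
Qed.

Lemma l2_delta_exists x : exists f : l2, forall y, f y = (y == x)%:R.
Proof.
have [|f fE _] := @l2_le_of_fin (fun y => (y == x)%:R) (theta x); last by exists f.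
move=> F uF; have [xF|xF] := boolP (x \in F).
  rewrite (bigD1_seq x)//= eqxx expr1n mul1r big1 ?addr0// => y /negbTE ->.
  by rewrite expr0n mul0r.
rewrite big_seq big1 ?ltW// => y yF; case: eqP => [yx|]; last first.
  by rewrite expr0n mul0r.
by rewrite -yx yF in xF.
Qed.

Definition l2_delta x : l2 := sval (cid (l2_delta_exists x)).

Lemma l2_deltaE x y : l2_delta x y = (y == x)%:R.
Proof. exact: (svalP (cid (l2_delta_exists x))). Qed.

Lemma l2_ip_delta f x : l2_ip f (l2_delta x) = f x * theta x.
Proof.
rewrite -(rsum_at x (f x * theta x)); congr rsum; apply/funext => y.
by rewrite l2_deltaE; case: eqP => [->|]; rewrite ?mulr1 ?mulr0 ?mul0r ?mul1r.
Qed.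

(** Take a finite set [F] carrying all but less than e^2 of |f|^2. The remainder [h] is 0 on [F] and
    equals [f] elsewhere, so |h|^2 = <f, h> is the missing part. *)
Lemma l2_truncate f e : 0 < e -> exists F : seq G,
  ipnorm l2_ip (f - \sum_(x <- F) f x *: l2_delta x) < e.
Proof.
move=> e0; have hip := l2_inner_product.
have [F uF Ff] : exists2 F : seq G, uniq F &
    l2_ip f f - e ^+ 2 < \sum_(x <- F) f x ^+ 2 * theta x.
  apply: contrapT => H.
  have := @nsum_le_fin_sum _ _ (fun x => f x ^+ 2 * theta x) (l2_ip f f - e ^+ 2).
  case.
  - by move=> x; rewrite mulr_ge0 ?sqr_ge0 ?ltW.
  - by move=> F uF; rewrite leNgt; apply/negP => lt; apply: H; exists F.
  - by move=> _; rewrite -l2_ip_nsum; have := exprn_gt0 2 e0; lra.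
exists F; set h := f - _.
have hE x : h x = if x \in F then 0 else f x.
  rewrite /h (_ : _ x = f x - (\sum_(x <- F) f x *: l2_delta x) x)// l2_sumE.
  have E y : (f y *: l2_delta y) x = f y * (x == y)%:R by rewrite -l2_deltaE.
  under eq_bigr do rewrite E.
  have [xF|xF] := boolP (x \in F).
    rewrite (bigD1_seq x)//= eqxx mulr1 big1 ?addr0 ?subrr// => y.
    by rewrite eq_sym => /negbTE ->; rewrite mulr0.
  rewrite big_seq big1 ?subr0// => y yF; case: eqP => [xy|]; last by rewrite mulr0.
  by rewrite xy yF in xF.
have hh : l2_ip h h = l2_ip f h.
  by congr rsum; apply/funext => x; rewrite hE; case: ifP => //; rewrite !mulr0.
rewrite -ltr_sqr ?nnegrE ?ipnorm_ge0 ?ltW// (sqr_ipnorm hip) hh /h.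
rewrite !(ipE hip) (ipC hip f) (ip_suml hip).
under eq_bigr do rewrite !(ipE hip) (ipC hip) l2_ip_delta mulrA -expr2.
lra.
Qed.

(** Pairing with [g] differs from pairing with a truncation of [g] by less than e / 2 uniformly in
    [j], and the latter is a finite sum of null sequences. *)
Lemma l2_weakly_null (u : nat -> l2) : (forall j, l2_ip (u j) (u j) = 1) ->
  (forall x, (fun j => u j x : R) @ \oo --> (0 : R)) ->
  forall g, (fun j => l2_ip (u j) g) @ \oo --> (0 : R).
Proof.
move=> u1 u0 g; have hip := l2_inner_product.
apply/cvgrPdist_lt => e e0.
have e20 : 0 < e / 2 by rewrite divr_gt0.
have [F Fe] := l2_truncate g e20.
have : (fun j => \sum_(x <- F) g x * (u j x * theta x)) @ \oo --> \sum_(x <- F) (0 : R).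
  apply: cvgn_seq_sum => x; rewrite -[X in _ --> X](mulr0 (g x)).
  by apply: cvgMr; rewrite -[X in _ --> X](mul0r (theta x)); exact: cvgMl.
rewrite big1// => /cvgrPdist_lt/(_ _ e20) H.
near=> j; have : `|0 - \sum_(x <- F) g x * (u j x * theta x)| < e / 2 by near: j.
rewrite !sub0r !normrN => lt1.
have -> : l2_ip (u j) g = l2_ip (u j) (g - \sum_(x <- F) g x *: l2_delta x) +
    \sum_(x <- F) g x * (u j x * theta x).
  rewrite -[in LHS](subrK (\sum_(x <- F) g x *: l2_delta x) g) (ipE hip).
  congr (_ + _); rewrite (ipC hip) (ip_suml hip); apply: eq_bigr => x _.
  by rewrite (ipE hip) (ipC hip) l2_ip_delta.
rewrite (le_lt_trans (ler_normD _ _))// (splitr e) ltrD//.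
rewrite (le_lt_trans (cauchy_schwarz hip _ _))//.
by rewrite /ipnorm u1 sqrtr1 mul1r.
Unshelve. all: by end_near. Qed.

End l2_theory.

(** * The Laplacian on l2(theta) *)

(** Tonelli: both iterated sums equal the sum over pairs. *)
Lemma esum_swap (R : realType) (G : choiceType) (a : G -> G -> \bar R) :
  (forall x y, 0 <= a x y)%E ->
  (\esum_(x in [set: G]) \esum_(y in [set: G]) a x y =
   \esum_(y in [set: G]) \esum_(x in [set: G]) a x y)%E.
Proof.
move=> a0; rewrite !esum_esum//.
rewrite (@reindex_esum _ _ _ ([set: G] `*`` (fun=> [set: G]))
  ([set: G] `*`` (fun=> [set: G])) (fun p => (p.2, p.1)))//.
split=> //.
- by move=> [x y] [x' y'] _ _ [-> ->].
- by move=> [x y] _; exists (y, x).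
Qed.

Lemma rsum_le (R : realType) (G : choiceType) (h g : G -> R) :
  summ h -> summ g -> (forall x, h x <= g x) -> rsum h <= rsum g.
Proof.
move=> sh sg hg.
have d0 x : 0 <= g x - h x by rewrite subr_ge0.
have sd : summ (fun x => g x - h x).
  apply: summ_le (summD sg (summZ (-1) sh)) => x.
  by rewrite mulN1r.
have -> : g = (fun x => (g x - h x) + h x) by apply/funext => x; rewrite subrK.
by rewrite rsumD// lerDr rsum_nsum// nsum_ge0.
Qed.

(** Discriminant of the nonnegative quadratic t -> sum of w_i (a_i - t)^2. *)
Lemma sqr_sum_weight_le (R : realType) (I : Type) (r : seq I) (w a : I -> R) :
  (forall i, 0 <= w i) ->
  (\sum_(i <- r) w i * a i) ^+ 2 <=
  (\sum_(i <- r) w i) * \sum_(i <- r) w i * a i ^+ 2.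
Proof.
move=> w0; set s := \sum_(i <- r) w i; set b := \sum_(i <- r) w i * a i.
set c := \sum_(i <- r) w i * a i ^+ 2.
have H t : 0 <= c - 2 * t * b + t ^+ 2 * s.
  have : 0 <= \sum_(i <- r) w i * (a i - t) ^+ 2.
    by apply: sumr_ge0 => i _; rewrite mulr_ge0 ?sqr_ge0.
  congr (0 <= _); rewrite /c /b /s !mulr_sumr -sumrB -big_split/=.
  by apply: eq_bigr => i _; ring.
have s0 : 0 <= s by apply: sumr_ge0.
have [s1|s1] := eqVneq s 0.
  rewrite s1 mul0r; have [->|b0] := eqVneq b 0; first by rewrite expr0n.
  have := H ((c + 1) / (2 * b)); rewrite s1.
  have -> : c - 2 * ((c + 1) / (2 * b)) * b + ((c + 1) / (2 * b)) ^+ 2 * 0 = -1.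
    by field.
  by rewrite ler0N1.
have {}s1 : 0 < s by rewrite lt_neqAle eq_sym s1.
have := H (b / s).
have -> : c - 2 * (b / s) * b + (b / s) ^+ 2 * s = (s * c - b ^+ 2) / s.
  by field; rewrite gt_eqF.
by rewrite pmulr_lge0 ?invr_gt0// subr_ge0.
Qed.

Section bounded_laplacian.
Context {R : realType} {G : countType}.
Variables (E : rel G) (w : G -> G -> R) (theta : G -> R).
Hypothesis hG : weighted_graph E w.
Hypothesis theta_gt0 : forall x, 0 < theta x.
Local Notation l2 := (l2 theta_gt0).
Local Notation ip := (@l2_ip R G theta theta_gt0).
Local Notation hip := (@l2_inner_product R G theta theta_gt0).

Definition neighbors x : seq G := finmap.enum_fset (fset_set [set y | E x y]).

Lemma mem_neighbors x y : (y \in neighbors x) = E x y.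
Proof.
have := in_fset_set (wg_locally_finite hG x) y.
by move=> ->; apply/idP/idP; rewrite inE.
Qed.

Lemma neighbors_uniq x : uniq (neighbors x).
Proof. exact: finmap.fset_uniq. Qed.

Definition degree x : R := \sum_(y <- neighbors x) w x y.

Variable K : R.
Hypothesis degree_le : forall x, degree x <= K * theta x.

Lemma weight_eq0 x y : ~~ E x y -> w x y = 0.
Proof.
move=> /negP Exy; apply/eqP; rewrite eq_le (wg_weight_ge0 hG) andbT leNgt.
by apply/negP => /(wg_weight_gt0 hG).
Qed.

Lemma fsum_neighbors x (f : G -> R) :
  \sum_(y \in [set y | E x y]) f y = \sum_(y <- neighbors x) f y.
Proof. exact/fsbig_finite/(wg_locally_finite hG). Qed.

Lemma esum_neighbors x (h : G -> R) : (forall y, 0 <= h y) ->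
  (\esum_(y in [set: G]) (w x y * h y)%:E =
   (\sum_(y <- neighbors x) w x y * h y)%:E)%E.
Proof.
move=> h0; have wh0 y : 0 <= w x y * h y by rewrite mulr_ge0// (wg_weight_ge0 hG).
transitivity (\esum_(y in [set y | E x y]) (w x y * h y)%:E)%E.
  rewrite [RHS]esum_mkcond; apply: eq_esum => y _; case: ifPn => //.
  by rewrite notin_setE /= => /negP nE; rewrite weight_eq0// mul0r.
rewrite esum_fset; last 2 first.
- exact: (wg_locally_finite hG).
- by move=> y _; rewrite lee_fin.
by rewrite fsbig_finite ?sumEFin//; exact: (wg_locally_finite hG).
Qed.

(** Double counting: [w] vanishes off the edges, so the inner sum extends to all vertices; exchange
    the sums and use the symmetry of [w]. *)
Lemma nsum_neighbors (h : G -> R) : (forall x, 0 <= h x) ->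
  (\esum_(x in [set: G]) (\sum_(y <- neighbors x) w x y * h y)%:E =
   \esum_(x in [set: G]) (degree x * h x)%:E)%E.
Proof.
move=> h0.
under eq_esum do rewrite -esum_neighbors//.
rewrite esum_swap; last first.
  by move=> x y; rewrite lee_fin mulr_ge0// (wg_weight_ge0 hG).
apply: eq_esum => y _.
have := @esum_neighbors y (fun=> h y) (fun=> h0 y).
rewrite -mulr_suml => <-; apply: eq_esum => x _.
by rewrite (wg_weight_sym hG).
Qed.

Section function.
Variable f : l2.

(** Together with [in_energy] this splits the sum over y of w x y (f x^2 + f y^2); the halves have
    equal totals over x ([nsum_in_energy]), each at most K |f|^2. *)
Definition out_energy x : R := degree x * f x ^+ 2.
Definition in_energy x : R := \sum_(y <- neighbors x) w x y * f y ^+ 2.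

Let f2 x : 0 <= f x ^+ 2. Proof. exact: sqr_ge0. Qed.

Lemma degree_ge0 x : 0 <= degree x.
Proof. by apply: sumr_ge0 => y _; exact: (wg_weight_ge0 hG). Qed.

Lemma out_energy_ge0 x : 0 <= out_energy x.
Proof. by rewrite mulr_ge0// degree_ge0. Qed.

Lemma in_energy_ge0 x : 0 <= in_energy x.
Proof. by apply: sumr_ge0 => y _; rewrite mulr_ge0// (wg_weight_ge0 hG). Qed.

Let out_energy_le x : out_energy x <= K * (f x ^+ 2 * theta x).
Proof. by rewrite /out_energy [leRHS]mulrCA [leLHS]mulrC ler_wpM2l. Qed.

Lemma out_energy_summ : summ out_energy.
Proof.
apply: summ_le (summZ K (l2_summ f)) => x.
by rewrite (ger0_norm (out_energy_ge0 x)) (le_trans (out_energy_le x))// ler_norm.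
Qed.

Lemma in_energy_summ : summ in_energy.
Proof.
rewrite /summ; under eq_esum do rewrite (ger0_norm (in_energy_ge0 _)).
rewrite nsum_neighbors//.
have := out_energy_summ; rewrite /summ.
by under eq_esum do rewrite (ger0_norm (out_energy_ge0 _)).
Qed.

Lemma nsum_in_energy : nsum in_energy = nsum out_energy.
Proof. by rewrite /nsum nsum_neighbors. Qed.

Lemma nsum_out_energy_le : nsum out_energy <= K * ip f f.
Proof.
have sf := l2_summ f.
have -> : K * ip f f = rsum (fun x => K * (f x ^+ 2 * theta x)).
  rewrite rsumZ// rsum_nsum ?l2_ip_nsum// => x; exact: l2_term_ge0.
rewrite -rsum_nsum; [|exact: out_energy_ge0|exact: out_energy_summ].
by apply: rsum_le => //; [exact: out_energy_summ|exact: summZ].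
Qed.

End function.

Lemma laplacianE (f : G -> R^o) x : - laplacian E w theta f x =
  (theta x)^-1 * \sum_(y <- neighbors x) w x y * (f x - f y).
Proof.
rewrite /laplacian fsum_neighbors -mulrN -sumrN; congr (_ * _).
by apply: eq_bigr => y _; rewrite -mulrN opprB.
Qed.

(** Cauchy-Schwarz with weights [w x y], then (p - q)^2 <= 2 (p^2 + q^2) and the degree bound. *)
Lemma laplacian_sqr_le (f : l2) x :
  (laplacian E w theta f x) ^+ 2 * theta x <=
  2 * K * (out_energy f x + in_energy f x).
Proof.
have t0 := theta_gt0 x.
rewrite -sqrrN laplacianE exprMn.
set s := \sum_(y <- _) _.
have s1 : s ^+ 2 <= degree x * \sum_(y <- neighbors x) w x y * (f x - f y) ^+ 2.
  by apply: sqr_sum_weight_le => y; exact: (wg_weight_ge0 hG).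
have s2 : \sum_(y <- neighbors x) w x y * (f x - f y) ^+ 2 <=
    2 * (out_energy f x + in_energy f x).
  rewrite /out_energy /in_energy /degree mulr_suml -big_split/= mulr_sumr.
  apply: ler_sum => y _; rewrite -mulrDr [leRHS]mulrCA ler_wpM2l ?(wg_weight_ge0 hG)//.
  have le (p q : R) : (p - q) ^+ 2 <= 2 * (p ^+ 2 + q ^+ 2).
    by have := sqr_ge0 (p + q); nra.
  exact: le.
have s3 : 0 <= out_energy f x + in_energy f x.
  by rewrite addr_ge0 ?out_energy_ge0 ?in_energy_ge0.
have -> : (theta x)^-1 ^+ 2 * s ^+ 2 * theta x = s ^+ 2 / theta x.
  by field; rewrite gt_eqF.
rewrite ler_pdivrMr// (le_trans s1)//.
apply: (le_trans (ler_wpM2l (degree_ge0 x) s2)).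
have := ler_wpM2r s3 (degree_le x); lra.
Qed.

Lemma laplacian_L2 (f : l2) : L2 theta (- laplacian E w theta f).
Proof.
apply/(L2_summ theta_gt0).
apply: summ_le (summZ (2 * K) (summD (out_energy_summ f) (in_energy_summ f))) => x.
rewrite ger0_norm; last by rewrite pmulr_lge0// sqr_ge0.
apply: le_trans (ler_norm _); apply: le_trans (laplacian_sqr_le f x).
by rewrite -[X in X * _ <= _]sqrrN opprK.
Qed.

(** The sign is that of the nonnegative operator -L; the degree bound makes it defined on all of
    l2. *)
Definition l2_laplacian (f : l2) : l2 := l2_of (laplacian_L2 f).

Lemma l2_laplacianE f x : l2_laplacian f x =
  (theta x)^-1 * \sum_(y <- neighbors x) w x y * (f x - f y).
Proof. by rewrite -laplacianE. Qed.

Lemma l2_laplacian_linear a (f g : l2) :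
  l2_laplacian (a *: f + g) = a *: l2_laplacian f + l2_laplacian g.
Proof.
apply: l2_ext => x; rewrite [RHS]l2E !l2_laplacianE.
rewrite mulrCA -mulrDr; congr (_ * _).
rewrite mulr_sumr -big_split/=; apply: eq_bigr => y _.
transitivity (w x y * ((a * f x + g x) - (a * f y + g y))); first by [].
by ring.
Qed.

Hypothesis K_gt0 : 0 < K.

Lemma l2_laplacian_bound (f : l2) :
  ipnorm ip (l2_laplacian f) <= (2 * K) * ipnorm ip f.
Proof.
have K20 : 0 <= 2 * K by rewrite mulr_ge0// ltW.
rewrite -ler_sqr ?nnegrE ?(mulr_ge0 K20) ?ipnorm_ge0// exprMn.
rewrite (sqr_ipnorm hip) (sqr_ipnorm hip) [leLHS]l2_ip_nsum.
set P := out_energy f; set Q := in_energy f.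
have P0 := @out_energy_ge0 f; have Q0 := @in_energy_ge0 f.
have sP := out_energy_summ f; have sQ := in_energy_summ f.
have sPQ := summD sP sQ.
have PQ0 x : 0 <= P x + Q x by rewrite addr_ge0.
apply: (@le_trans _ _ (nsum (fun x => 2 * K * (P x + Q x)))).
  apply: nsum_le; last exact: summZ.
  move=> x; rewrite l2_term_ge0/=.
  apply: le_trans (laplacian_sqr_le f x).
  by rewrite -[X in _ <= X * _]sqrrN.
rewrite nsumZ// nsumD// nsum_in_energy -/P.
have := nsum_out_energy_le f; rewrite -/P => le.
have := ler_wpM2l K20 le; lra.
Qed.

(** Here -L delta_y is explicit: (degree y / theta y) delta_y minus the sum of (w y z / theta z)
    delta_z over the neighbours z, so both sides are finite sums. *)
Lemma ip_laplacian_delta (f : l2) y :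
  ip (l2_laplacian f) (l2_delta y) = ip f (l2_laplacian (l2_delta y)).
Proof.
have t0 x : theta x != 0 by rewrite gt_eqF.
have -> : l2_laplacian (l2_delta y) = (degree y / theta y) *: l2_delta y -
    \sum_(z <- neighbors y) (w y z / theta z) *: l2_delta z.
  apply: l2_ext => x.
  have -> (g h : l2) a : l2_fun (a *: g - h) x = a * g x - h x by [].
  rewrite l2_laplacianE l2_sumE.
  have Dz z a : l2_fun (a *: (l2_delta z : l2)) x = a * (x == z)%:R.
    by rewrite -[in RHS](@l2_deltaE _ _ _ theta_gt0).
  under [X in _ = _ - X]eq_bigr do rewrite Dz.
  under [in LHS]eq_bigr do rewrite mulrBr.
  rewrite sumrB -mulr_suml !l2_deltaE mulrBr mulrA.
  congr (_ - _).
    by case: eqP => [->|_]; rewrite ?mulr0// !mulr1 mulrC.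
  have [Exy|nE] := boolP (E x y).
    have yx : y \in neighbors x by rewrite mem_neighbors.
    have xy : x \in neighbors y by rewrite mem_neighbors (wg_edge_sym hG).
    rewrite (bigD1_seq y)//= ?neighbors_uniq// (bigD1_seq x)//= ?neighbors_uniq//.
    rewrite !big1 ?addr0.
    - by rewrite l2_deltaE !eqxx !mulr1 (wg_weight_sym hG) mulrC.
    - by move=> z; rewrite eq_sym => /negbTE ->; rewrite mulr0.
    - by move=> z /negbTE zy; rewrite l2_deltaE zy mulr0.
  rewrite !big_seq !big1 ?mulr0//.
  - move=> z; rewrite mem_neighbors (wg_edge_sym hG) => Ezy.
    by case: eqP => [xz|]; rewrite ?mulr0//; rewrite xz Ezy in nE.
  - move=> z; rewrite mem_neighbors l2_deltaE => Exz.
    by case: eqP => [zy|]; rewrite ?mulr0//; rewrite -zy Exz in nE.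
rewrite l2_ip_delta l2_laplacianE !(ipE hip) (ipC hip f (\sum_(_ <- _) _)).
rewrite (ip_suml hip) l2_ip_delta.
rewrite mulrAC mulVf// mul1r.
have -> : degree y / theta y * (f y * theta y) = degree y * f y by field.
rewrite /degree mulr_suml -sumrB; apply: eq_bigr => z _.
by rewrite (ipE hip) (ipC hip) l2_ip_delta mulrBr; field.
Qed.

Lemma l2_laplacian_bounded_symmetric : bounded_symmetric ip l2_laplacian.
Proof.
split; first exact: l2_laplacian_linear.
  move=> f g; apply/eqP; rewrite -subr_eq0 -normr_le0.
  have K20 : 0 < 2 * K by rewrite mulr_gt0.
  apply/ler_addgt0Pr => e e0; rewrite add0r.
  (* Symmetry holds exactly against the truncation [h] of [g]; each of the two terms left over is at
     most 2 K |f| |g - h|, and the 1 keeps [C] positive. *)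
  set C := 4 * K * ipnorm ip f + 1.
  have C0 : 0 < C by rewrite ltr_wpDl// !mulr_ge0 ?ipnorm_ge0// ltW.
  have [F] := l2_truncate g (divr_gt0 e0 C0).
  set h := \sum_(x <- F) _ => gh.
  have fh : ip (l2_laplacian f) h = ip f (l2_laplacian h).
    rewrite /h; elim: (F) => [|x s IH].
      rewrite !big_nil (ipE hip).
      have := l2_laplacian_linear (-1) 0 0; rewrite scaler0 addr0 scaleN1r addNr.
      by move=> ->; rewrite (ipE hip).
    rewrite !big_cons l2_laplacian_linear !(ipE hip) IH ip_laplacian_delta//.
  have -> : ip (l2_laplacian f) g - ip f (l2_laplacian g) =
      ip (l2_laplacian f) (g - h) - ip f (l2_laplacian (g - h)).
    have -> : g - h = (-1) *: h + g by rewrite scaleN1r addrC.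
    by rewrite l2_laplacian_linear !(ipE hip) fh; ring.
  move: (g - h) gh => k /ltW; rewrite ler_pdivlMr// => kC.
  rewrite (le_trans _ kC)// (le_trans (ler_normB _ _))//.
  have h1 := cauchy_schwarz hip (l2_laplacian f) k.
  have h2 := cauchy_schwarz hip f (l2_laplacian k).
  have h3 := ler_wpM2r (ipnorm_ge0 ip k) (l2_laplacian_bound f).
  have h4 := ler_wpM2l (ipnorm_ge0 ip f) (l2_laplacian_bound k).
  have h5 := ipnorm_ge0 ip k.
  have -> : ipnorm ip k * C = 2 * K * ipnorm ip f * ipnorm ip k +
    ipnorm ip f * (2 * K * ipnorm ip k) + ipnorm ip k by rewrite /C; ring.
  lra.
exists (2 * K); first by rewrite mulr_gt0.
exact: l2_laplacian_bound.
Qed.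

(* The inequality is [(f x - f y)^2 <= phi (f x ^2 + f y ^2)] on edges. *)
Lemma rayleigh_le (f : l2) phi : 0 <= phi ->
  (forall x y, E x y -> (1 - phi) * (f x ^+ 2 + f y ^+ 2) <= 2 * (f x * f y)) ->
  ip (l2_laplacian f) f <= phi * K * ip f f.
Proof.
move=> phi0 fE; set P := out_energy f; set Q := in_energy f.
have P0 := @out_energy_ge0 f; have Q0 := @in_energy_ge0 f.
have sP := out_energy_summ f; have sQ := in_energy_summ f.
(* A majorant of (-L f)(x) f(x) theta x, from w (f x - f y) f x <= w ((phi + 1) f x^2 + (phi - 1) f
   y^2) / 2 on each edge. As [P] and [Q] have equal totals, it sums to phi times the total of
   [P]. *)
pose g x := (phi + 1) / 2 * P x + (phi - 1) / 2 * Q x.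
have sg : summ g by apply: summD; exact: summZ.
apply: (@le_trans _ _ (rsum g)).
  apply: rsum_le => //; first exact: (L2_mul_summ theta_gt0 (l2_L2 _) (l2_L2 _)).
  move=> x; rewrite l2_laplacianE.
  have t0 : theta x != 0 by rewrite gt_eqF.
  set s := \sum_(_ <- _) _.
  have -> : (theta x)^-1 * s * f x * theta x = s * f x by field.
  rewrite /s mulr_suml /g /P /Q /out_energy /in_energy /degree.
  rewrite mulr_suml !mulr_sumr -big_split/= !big_seq; apply: ler_sum => y.
  rewrite mem_neighbors => Exy; have := fE x y Exy.
  have := wg_weight_ge0 hG x y.
  move: (w x y) => c c0 le; rewrite -subr_ge0.
  have -> : (phi + 1) / 2 * (c * f x ^+ 2) + (phi - 1) / 2 * (c * f y ^+ 2) -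
     c * (f x - f y) * f x =
     c / 2 * (2 * (f x * f y) - (1 - phi) * (f x ^+ 2 + f y ^+ 2)) by field.
  by rewrite mulr_ge0 ?subr_ge0// divr_ge0.
rewrite rsumD; [|exact: summZ|exact: summZ].
rewrite !rsumZ// !rsum_nsum//.
have -> : nsum Q = nsum P by exact: nsum_in_energy.
have := ler_wpM2l phi0 (nsum_out_energy_le f); rewrite -/P; lra.
Qed.

(** * Upper bounds for the bottom of the essential spectrum *)

Lemma lambda0_ess_le_singular (v : nat -> l2) L :
  singular_sequence ip l2_laplacian L v -> (lambda0_ess E w theta <= L%:E)%E.
Proof.
move=> vL.
have [l lL [sl al]] := essential_spectrum_of_singular_sequence hip
  (@l2_complete _ _ _ _) l2_laplacian_bounded_symmetric vL.
have D f : laplacian_domain E w theta (f : l2).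
  split; first exact: l2_L2.
  have := laplacian_L2 f => /(L2_summ theta_gt0) H; apply/(L2_summ theta_gt0).
  by apply: summ_le H => x; rewrite -[X in _ <= `|X * _|]sqrrN opprK.
have NE (f : l2) : normL2 theta f = ipnorm ip f.
  by rewrite /ipnorm l2_ip_nsum.
(* A bound [C] on the inverse makes the operator bounded below by 1 / (|C| + 1), which is positive
   whatever the sign of [C]. *)
have sub l' : approx_spectrum ip l2_laplacian l' ->
    spectrum (L2 theta) (normL2 theta) (laplacian_domain E w theta)
      (fun f => - laplacian E w theta f) l'.
  move=> sl' [_ [C HC]]; apply: sl'; exists (`|C| + 1)^-1.
    by rewrite invr_gt0 ltr_wpDl.
  move=> u; rewrite ler_pdivrMl ?ltr_wpDl//.
  have := HC u (D u).
  have -> : - laplacian E w theta u - l' *: (u : G -> R^o) =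
    (l2_laplacian u - l' *: u : l2) by [].
  rewrite !NE => /le_trans; apply.
  by rewrite ler_wpM2r ?ipnorm_ge0// (le_trans (ler_norm C))// lerDl.
apply: (@le_trans _ _ l%:E); last by rewrite lee_fin.
apply: ereal_inf_lbound; exists l => //; split; first exact: sub.
have [lp|nlp] := pselect (limit_point (spectrum (L2 theta) (normL2 theta)
   (laplacian_domain E w theta) (fun f => - laplacian E w theta f)) l).
  by left.
right; split.
  split; first by apply/mem_set; exact: sub.
  move: nlp; rewrite not_limit_pointE => -[X Xl XA].
  exists X => //; apply/seteqP; split; first by rewrite setIC.
  by move=> _ ->; split; [exact: nbhs_singleton|exact: sub].
case: al => [acc|inf]; first exfalso; first apply: nlp.
  move=> U /nbhs_ballP[d /= d0 dU].
  have [l' sl' /andP[ne lt]] := acc d d0; exists l'; split.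
  - by rewrite -subr_eq0 -normr_gt0.
  - exact: sub.
  - by apply: dU; rewrite /ball/= distrC.
move=> n; have [s [sn /andP[os ns] sT]] := inf n.
have s_mem (i : 'I_n) : nth 0 s i \in s by rewrite mem_nth// sn.
exists (fun i : 'I_n => l2_fun (nth 0 s i)); split.
  move=> i; split; first exact: D.
  by have := sT _ (s_mem i) => /(congr1 (@l2_fun _ _ _ _)).
move=> c c0 j.
(* The relation between functions is lifted to l2, where pairing with the j-th orthonormal vector
   isolates [c j]. *)
have {}c0 : \sum_(i < n) c i *: nth 0 s i = 0 :> l2.
  apply: l2_ext => x; rewrite l2_sumE.
  have := congr1 (fun f : G -> R^o => f x) c0; rewrite fct_sumE.
  by move=> c0x; apply: etrans c0x; apply: eq_bigr.
have := congr1 (fun f => ip f (nth 0 s j)) c0; rewrite (ipE hip) (ip_suml hip).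
rewrite (bigD1 j)//= big1 ?addr0.
  rewrite (ipE hip); have /eqP -> := allP ns _ (s_mem j).
  by rewrite mulr1.
move=> i ij; rewrite (ipE hip); apply/eqP; rewrite mulf_eq0; apply/orP; right.
have ij' : (i : nat) != j by [].
move: os => /(pairwiseP 0) os; have [lt|lt|/eqP] := ltngtP i j; last by rewrite (negbTE ij').
  by apply: os; rewrite ?inE ?sn.
by rewrite (ipC hip); apply: os; rewrite ?inE ?sn.
Qed.

Lemma lambda0_ess_le_rayleigh (u : nat -> l2) phi : 0 <= phi ->
  (forall j, 0 < ip (u j) (u j)) ->
  (forall x, (fun j => (ipnorm ip (u j))^-1 * u j x) @ \oo --> (0 : R)) ->
  (forall j x y, E x y ->
    (1 - phi) * (u j x ^+ 2 + u j y ^+ 2) <= 2 * (u j x * u j y)) ->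
  (lambda0_ess E w theta <= (phi * K)%:E)%E.
Proof.
move=> phi0 u_gt0 u_null uE.
have N_gt0 j : 0 < ipnorm ip (u j) by rewrite sqrtr_gt0.
pose v j := (ipnorm ip (u j))^-1 *: u j.
have v1 j : ip (v j) (v j) = 1.
  rewrite /v !(ipE hip) -(sqr_ipnorm hip (u j)); field.
  by rewrite gt_eqF.
apply: (@lambda0_ess_le_singular v); split.
- by apply: l2_weakly_null => // x; exact: u_null.
- by under eq_fun do rewrite v1; exact: cvg_cst.
- move=> h h0; apply: nearW => j; rewrite -(ltrD2r (- h)) addrK.
  have : ip (l2_laplacian (v j)) (v j) <= phi * K.
    rewrite /v (bsZ l2_laplacian_bounded_symmetric) !(ipE hip) mulrA -expr2.
    rewrite exprVn (sqr_ipnorm hip) mulrC ler_pdivrMr//.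
    by apply: rayleigh_le => // x y; exact: uE.
  lra.
Qed.

(** Vertices of growing code form a sequence that eventually avoids each given vertex. *)
Lemma exists_pickle_ge (x0 : G) n : exists x : G, (n <= pickle x)%N.
Proof.
apply: contrapT => H; apply: (wg_infinite hG).
apply: (@sub_finite_set _ _ ((fun k => odflt x0 (unpickle k)) @` `I_n)).
  move=> x _; exists (pickle x); last by rewrite pickleK.
  by rewrite /= ltnNge; apply/negP => le; apply: H; exists x.
exact/finite_image/finite_II.
Qed.

(** Delta functions with phi = 1: the edge condition then reads 0 <= 2 f x f y, true of nonnegative
    functions, and at each fixed vertex the sequence is eventually 0. *)
Lemma lambda0_ess_le_degree (x0 : G) : (lambda0_ess E w theta <= K%:E)%E.
Proof.
pose X n := sval (cid (exists_pickle_ge x0 n)).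
have XE n : (n <= pickle (X n))%N := svalP (cid (exists_pickle_ge x0 n)).
rewrite -[K]mul1r; apply: (@lambda0_ess_le_rayleigh (fun n => l2_delta (X n))) => //.
- by move=> j; rewrite l2_ip_delta l2_deltaE eqxx mul1r.
- move=> y; apply: cvg_near_cst; near=> n.
  rewrite l2_deltaE; case: eqP => [yX|_]; last exact: (mulr0 (_ : R)).
  have : ((pickle y).+1 <= n)%N by near: n; exists (pickle y).+1.
  by rewrite yX ltnNge XE.
- move=> j x y _; rewrite subrr mul0r mulr_ge0// mulr_ge0// l2_deltaE ler0n.
Unshelve. all: by end_near. Qed.

End bounded_laplacian.

(** * Volume growth and test functions *)

Section volume_growth.
Context {R : realType} {G : countType}.
Variables (theta : G -> R) (rho : G -> G -> R) (x0 : G).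
Hypothesis theta_gt0 : forall x, 0 < theta x.
Hypothesis rho_ge0 : forall x y, 0 <= rho x y.
Local Notation vol := (volume theta rho x0).

Lemma volume_ge0 r : (0 <= vol r)%E.
Proof. by apply: esum_ge0 => x _; rewrite lee_fin ltW. Qed.

Lemma volume_mono r s : r <= s -> (vol r <= vol s)%E.
Proof.
move=> rs; rewrite /volume esum_mkcond [leRHS]esum_mkcond; apply: le_esum => x _.
case: ifPn => [|_]; last by case: ifP => // _; rewrite lee_fin ltW.
rewrite inE /= => xr; rewrite mem_set//=; exact: le_trans xr rs.
Qed.

Lemma fin_sum_le_volume r (F : seq G) : uniq F ->
  (forall x, x \in F -> rho x0 x <= r) ->
  ((\sum_(x <- F) theta x)%:E <= vol r)%E.
Proof.
move=> uF Fr; rewrite -sumEFin; apply: esum_ge; exists [set` F].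
  by split; [exact: finite_seq|exact: Fr].
by rewrite fsbig_seq.
Qed.

(** Unwinds the limsup. The rate [b'] stays strictly below [b], so that the geometric series in
    [sum_exp_dist_le] has ratio below 1. *)
Lemma volume_le_exp (mu b : R) : (volume_growth theta rho x0 < b%:E)%E ->
  exists C, exists2 b', b' < b & 0 < C /\
  forall k : nat, (vol k%:R <= (C * expR (b' * k%:R))%:E)%E.
Proof.
move=> /ereal_inf_lt[_ [V [A [_ AV]] <-] supV].
(* The supremum may be -oo; then b - 1 serves as the smaller rate. *)
have [b' b'b supb'] : exists2 b', b' < b & (ereal_sup
    ((fun r : R => r^-1%:E * lne (vol r)) @` V) <= b'%:E)%E.
  move: supV; case: (ereal_sup _) => [s||]//.
  - by rewrite lte_fin => sb; exists s.
  - by move=> _; exists (b - 1); rewrite ?leNye// ltrBlDr ltrDl.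
have [N NA] : exists N : nat, forall k : nat, (N <= k)%N -> A < k%:R /\ 0 < k%:R :> R.
  exists (Num.trunc `|A|).+1 => k Nk.
  have kA : A < k%:R.
    rewrite (le_lt_trans (ler_norm A))// (lt_le_trans (truncnS_gt _))//.
    by rewrite ler_nat.
  by split=> //; rewrite ltr0n (leq_trans _ Nk).
have big_vol k : (N <= k)%N -> (vol k%:R <= (expR (b' * k%:R))%:E)%E.
  move=> /NA[Ak k0].
  have : (k%:R^-1%:E * lne (vol k%:R) <= b'%:E)%E.
    apply: le_trans supb'; apply: ereal_sup_ubound; exists k%:R => //.
    exact: AV.
  rewrite lee_pdivrMl// -EFinM => le.
  rewrite -[leLHS](@lneK R) ?in_itv/= ?volume_ge0 ?leey//.
  rewrite (_ : (expR (b' * k%:R))%:E = expeR (k%:R * b')%:E); last by rewrite mulrC.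
  by rewrite lee_expeR.
(* For k < N, monotonicity gives vol k <= vol N <= exp (b' N), and b' N <= |b'| N + b' k whatever
   the sign of [b']. *)
exists (expR (`|b'| * N%:R)), b' => //; split; first exact: expR_gt0.
move=> k; rewrite -expRD.
apply: (@le_trans _ _ (vol (maxn N k)%:R)).
  by apply: volume_mono; rewrite ler_nat leq_maxr.
apply: (le_trans (big_vol _ (leq_maxl _ _))).
rewrite lee_fin ler_expR; have [Nk|kN] := leqP N k.
  by rewrite lerDr mulr_ge0.
have := ler_norm b'; have := ler_norm (- b'); rewrite normrN => h1 h2.
have h3 : k%:R <= N%:R :> R by rewrite ler_nat ltnW.
have h4 : 0 <= k%:R :> R by rewrite ler0n.
nra.
Qed.

(** Slice by distance rounded up to an integer. The slice at [i] lies in the ball of radius [i], so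
    its mass is at most C exp (b i), and the weights turn the sum into a geometric series of ratio
    exp (b - 2 a). *)
Lemma sum_exp_dist_le a : (volume_growth theta rho x0 < (2 * a)%:E)%E ->
  exists C, forall F : seq G, uniq F ->
    \sum_(x <- F) expR (- (2 * a * rho x0 x)) * theta x <= C.
Proof.
move=> /(volume_le_exp 0)[C [b bt [C0 volC]]].
pose q := expR (b - 2 * a).
have q0 : 0 < q by exact: expR_gt0.
have q1 : q < 1 by rewrite expR_lt1 subr_lt0.
(* The factor exp |2 a| pays for rounding distances to [k x], off by at most 1; [a] may have either
   sign. *)
exists (expR `|2 * a| * (C / (1 - q))) => F uF.
pose k x := (Num.trunc (rho x0 x)).+1.
have kP x : rho x0 x <= (k x)%:R <= rho x0 x + 1.
  have /andP[h1 h2] := truncn_itv (rho_ge0 x0 x).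
  by rewrite ltW//= /k -natr1 lerD2r.
pose g x := expR (- (2 * a * (k x)%:R)) * theta x.
apply: (@le_trans _ _ (\sum_(x <- F) expR `|2 * a| * g x)).
  apply: ler_sum => x _; rewrite /g mulrA -expRD ler_pM2r// ler_expR.
  have /andP[h1 h2] := kP x.
  have := ler_norm (2 * a); have := ler_norm (- (2 * a)); rewrite normrN.
  move: (`|2 * a|) (2 * a) h1 h2 => c d h1 h2 h3 h4; nra.
rewrite -mulr_sumr ler_pM2l ?expR_gt0//.
pose N := (\max_(x <- F) k x).+1.
have kN x : x \in F -> (k x < N)%N.
  by move=> xF; rewrite ltnS; exact: (@leq_bigmax_seq _ F xpredT k x xF).
apply: (@le_trans _ _ (\sum_(i < N) C * q ^+ i)); last first.
  rewrite -mulr_sumr ler_pM2l//; have := subrX1 q N; set s := \sum_(i < N) _ => sq.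
  rewrite -[_^-1]mul1r ler_pdivlMr ?subr_gt0//.
  have := exprn_ge0 N (ltW q0); lra.
have -> : \sum_(x <- F) g x = \sum_(i < N) \sum_(x <- F | k x == i) g x.
  rewrite (exchange_big_dep xpredT)//= !big_seq; apply: eq_bigr => x xF.
  rewrite (bigD1 (Ordinal (kN x xF)))//= big1 ?addr0// => i /andP[/eqP ki].
  by rewrite -val_eqE /= ki eqxx.
apply: ler_sum => i _.
have le : \sum_(x <- F | k x == i) theta x <= C * expR (b * i%:R).
  rewrite -big_filter -lee_fin (le_trans _ (volC i))//.
  apply: fin_sum_le_volume; first exact: filter_uniq.
  by move=> x; rewrite mem_filter => /andP[/eqP <- _]; case/andP: (kP x).
apply: (@le_trans _ _ (expR (- (2 * a * i%:R)) * \sum_(x <- F | k x == i) theta x)).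
  by rewrite mulr_sumr; apply: ler_sum => x /eqP ki; rewrite /g ki.
apply: le_trans (ler_wpM2l (expR_ge0 _) le) _.
rewrite mulrCA ler_pM2l// -expRD /q -expRM_natr ler_expR.
by rewrite mulrBl addrC.
Qed.

End volume_growth.

(** For t >= 1, the largest value of (p - q)^2 / (p^2 + q^2) over positive p, q whose ratio lies
    between 1 / t and t. *)
Definition bound_factor (R : realType) (t : R) : R := (1 - t) ^+ 2 / (1 + t ^+ 2).

(** The difference of the two sides is 2 (q t - p) (p t - q) / (1 + t^2). *)
Lemma bound_factor_edge (R : realType) (p q t : R) :
  p <= q * t -> q <= p * t ->
  (1 - bound_factor t) * (p ^+ 2 + q ^+ 2) <= 2 * (p * q).
Proof.
move=> pq qp; have t0 : 0 < 1 + t ^+ 2 by rewrite ltr_wpDr ?sqr_ge0.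
rewrite -subr_ge0.
have -> : 2 * (p * q) - (1 - bound_factor t) * (p ^+ 2 + q ^+ 2) =
    2 * ((q * t - p) * (p * t - q)) / (1 + t ^+ 2).
  by rewrite /bound_factor; field; rewrite gt_eqF.
by apply: divr_ge0; [rewrite !mulr_ge0 ?subr_ge0|exact: ltW].
Qed.

Lemma lambda0_ess_le_exp (R : realType) (G : countType) (E : rel G)
    (w : G -> G -> R) (theta : G -> R) (rho : G -> G -> R) (x0 : G) (K M a : R)
    (hG : weighted_graph E w) (theta_gt0 : forall x, 0 < theta x)
    (theta_inf : \esum_(x in [set: G]) (theta x)%:E = +oo%E)
    (hrho : is_metric rho) (K_gt0 : 0 < K)
    (degree_le : forall x, degree E w x <= K * theta x)
    (rho_le : forall x y, E x y -> rho x y <= M) :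
  0 < a -> (volume_growth theta rho x0 < (2 * a)%:E)%E ->
  (lambda0_ess E w theta <= (bound_factor (expR (a * M)) * K)%:E)%E.
Proof.
move=> a0 /(sum_exp_dist_le theta_gt0 (metric_ge0 hrho))[C FC].
(* The exponent rises with the distance up to radius [j] and falls beyond. [d_le] bounds the test
   functions at each vertex uniformly in [j]; [d_le2] gives the decay that puts them in l2. *)
pose d (j : nat) x := j%:R - `|rho x0 x - j%:R|.
have d_le j x : d j x <= rho x0 x.
  by rewrite /d; have := ler_norm (- (rho x0 x - j%:R)); rewrite normrN; lra.
have d_le2 j x : d j x <= 2 * j%:R - rho x0 x.
  by rewrite /d; have := ler_norm (rho x0 x - j%:R); lra.
have uP j : exists2 u : l2 theta_gt0, (forall x, u x = expR (a * d j x)) &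
    l2_ip u u <= expR (4 * a * j%:R) * C.
  apply: l2_le_of_fin => F uF.
  apply: le_trans (ler_wpM2l (expR_ge0 _) (FC F uF)).
  rewrite mulr_sumr; apply: ler_sum => x _.
  rewrite mulrA -expRD ler_pM2r// -expRM_natl ler_expR.
  have := ler_wpM2l (ltW a0) (d_le2 j x); lra.
pose u j := sval (cid2 (uP j)).
have uE j x : u j x = expR (a * d j x).
  by rewrite /u; case: cid2.
(* Once [j] exceeds all distances on [F] the exponent is nonnegative there, so u_j >= 1 on [F] and
   |u_j|^2 is at least the mass of [F], which can be as large as desired. *)
have u_large B : exists N, forall j, (N <= j)%N -> B <= l2_ip (u j) (u j).
  have [F uF BF] : exists2 F : seq G, uniq F & B <= \sum_(x <- F) theta x.
    apply: contrapT => H.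
    have [] := @nsum_le_fin_sum _ _ theta B.
    - by move=> x; exact: ltW.
    - by move=> F uF; rewrite leNgt; apply/negP => /ltW BF; apply: H; exists F.
    - rewrite /summ; under eq_esum do rewrite ger0_norm ?ltW//.
      by rewrite theta_inf.
  exists (\max_(x <- F) (Num.trunc (rho x0 x)).+1) => j Fj.
  apply: le_trans (l2_sqr_le (u j) uF); apply: (le_trans BF).
  rewrite !big_seq; apply: ler_sum => x xF.
  rewrite -[leLHS]mul1r ler_pM2r// exprn_ege1// uE -expR0 ler_expR.
  rewrite mulr_ge0 ?(ltW a0)// /d.
  have xj : rho x0 x <= j%:R.
    rewrite (le_trans (ltW (truncnS_gt _)))// ler_nat (leq_trans _ Fj)//.
    exact: (@leq_bigmax_seq _ F xpredT (fun x => (Num.trunc (rho x0 x)).+1)).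
  by rewrite ler0_norm ?subr_le0//; have := metric_ge0 hrho x0 x; lra.
apply: (@lambda0_ess_le_rayleigh _ _ _ _ _ hG theta_gt0 _ degree_le K_gt0 u).
- by rewrite divr_ge0 ?sqr_ge0// addr_ge0 ?sqr_ge0.
- move=> j; apply: (@lt_le_trans _ _ (u j x0 ^+ 2 * theta x0)).
    by rewrite mulr_gt0// exprn_gt0// uE expR_gt0.
  by have := l2_sqr_le (u j) (isT : uniq [:: x0]); rewrite big_seq1.
- move=> x; apply/cvgrPdist_le => e e0.
  (* From this index on, |u_j| >= exp (a rho) / e, while u_j x <= exp (a rho). *)
  have [N NB] := u_large ((expR (a * rho x0 x) / e) ^+ 2).
  exists N => // j /= Nj; rewrite sub0r normrN.
  have N0 : expR (a * rho x0 x) / e <= ipnorm (@l2_ip _ _ _ theta_gt0) (u j).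
    rewrite -ler_sqr ?nnegrE ?ipnorm_ge0 ?divr_ge0 ?expR_ge0 ?(ltW e0)//.
    by rewrite (sqr_ipnorm (@l2_inner_product _ _ _ theta_gt0)) NB.
  have N1 : 0 < ipnorm (@l2_ip _ _ _ theta_gt0) (u j).
    by apply: lt_le_trans N0; rewrite divr_gt0// expR_gt0.
  rewrite normrM gtr0_norm ?invr_gt0// ler_pdivrMl// uE gtr0_norm ?expR_gt0//.
  rewrite -ler_pdivrMr//; apply: le_trans N0; rewrite ler_pM2r ?invr_gt0//.
  by rewrite ler_expR ler_pM2l.
- move=> j x y Exy; rewrite !uE.
  (* [d j] is 1-Lipschitz for [rho], so the exponent changes by at most a M along an edge. *)
  have half z1 z2 : E z1 z2 -> expR (a * d j z1) <= expR (a * d j z2) * expR (a * M).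
    move=> Ez; rewrite -expRD -mulrDr ler_expR ler_pM2l// /d.
    have := ler_normB (rho x0 z1 - j%:R) (rho x0 z1 - rho x0 z2).
    have -> : rho x0 z1 - j%:R - (rho x0 z1 - rho x0 z2) = rho x0 z2 - j%:R by ring.
    have := Defs.metric_triangle hrho x0 z1 z2; have := Defs.metric_triangle hrho x0 z2 z1.
    rewrite (Defs.metric_sym hrho z2 z1); have := rho_le _ _ Ez => h1 h2 h3.
    have h4 : `|rho x0 z1 - rho x0 z2| <= M by rewrite ler_norml; lra.
    lra.
  apply: bound_factor_edge; apply: half => //.
  by rewrite (wg_edge_sym hG).
Qed.

Theorem theorem1p4 (R : realType) (G : countType) (E : rel G)
    (w : G -> G -> R) (theta : G -> R) (rho : G -> G -> R) (x0 : G) (m M : R)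
    (hG : weighted_graph E w)
    (htheta_gt0 : forall x, 0 < theta x)
    (htheta_inf : forall U : set G, infinite_set U -> connected_in E U ->
       \esum_(x in U) (theta x)%:E = +oo%E)
    (hrho : adapted_metric E w theta rho)
    (hm : 0 < m) (hM : 0 < M)
    (hmM : forall x y, E x y -> m <= rho x y /\ rho x y <= M) :
  (lambda0_ess E w theta
     <= ess_spectrum_bound m M (volume_growth theta rho x0))%E.
Proof.
have hmet := adapted_is_metric hrho.
have m2 : 0 < m ^+ 2 by exact: exprn_gt0.
have K0 : 0 < (m ^+ 2)^-1 by rewrite invr_gt0.
(* Adaptedness with rho >= m on edges: m^2 times the degree is at most [theta x]. *)
have degree_le x : degree E w x <= (m ^+ 2)^-1 * theta x.
  have := adapted_sum hrho x.
  rewrite (fsum_neighbors hG) ler_pdivrMl// mulr1 ler_pdivlMl//; apply: le_trans.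
  rewrite /degree mulr_sumr !big_seq; apply: ler_sum => y.
  rewrite (mem_neighbors hG) => /hmM[my _].
  rewrite mulrC ler_wpM2l ?(wg_weight_ge0 hG)//.
  by rewrite ler_sqr ?nnegrE ?(metric_ge0 hmet)// ltW.
have theta_inf : \esum_(x in [set: G]) (theta x)%:E = +oo%E.
  by apply: htheta_inf; [exact: (wg_infinite hG)|exact: (wg_connected hG)].
(* Both infinite values carry the bound 1 / m^2, which delta functions give. *)
case E_mu : (volume_growth theta rho x0) => [mu||] /=;
  try exact: (lambda0_ess_le_degree hG htheta_gt0 degree_le K0 x0).
(* For mu < 0, [sum_exp_dist_le] at a = 0 would bound the total mass. Nonnegativity makes every
   exponent above mu / 2 positive. *)
have mu0 : 0 <= mu.
  rewrite leNgt; apply/negP => mu_lt0.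
  have : (volume_growth theta rho x0 < (2 * 0)%:E)%E by rewrite E_mu mulr0 lte_fin.
  move=> /(sum_exp_dist_le htheta_gt0 (metric_ge0 hmet))[C FC].
  have [] := @nsum_le_fin_sum _ _ theta C (fun x => ltW (htheta_gt0 x)).
    move=> F /FC; apply: le_trans; apply: ler_sum => x _.
    by rewrite mulr0 mul0r oppr0 expR0 mul1r.
  rewrite /summ; under eq_esum do rewrite ger0_norm ?ltW//.
  by rewrite theta_inf.
(* The bound [psi a] holds for every a > mu / 2, and continuity carries it to mu / 2; below, a = mu
   / 2 + d / 2 lies within the radius [d] that continuity gives for [e]. *)
pose psi a := bound_factor (expR (a * M)) * (m ^+ 2)^-1.
have -> : (m ^+ 2)^-1 * ((1 - expR (2^-1 * M * mu)) ^+ 2 / (1 + expR (M * mu))) =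
    psi (mu / 2).
  rewrite /psi /bound_factor -expRM_natl mulrC; congr (_ / (1 + expR _) * _).
    by congr ((1 - expR _) ^+ 2); field.
  by field.
have exp_cvg : (fun a => expR (a * M)) @ (mu / 2) --> expR (mu / 2 * M).
  have mul_cvg : (fun a => a * M) @ (mu / 2) --> mu / 2 * M.
    by apply: cvgMl; exact: cvg_id.
  exact: (continuous_cvg _ (@continuous_expR R _) mul_cvg).
have psi_cvg : psi @ (mu / 2) --> psi (mu / 2).
  apply: cvgMl; apply: cvgM.
    by apply: cvgM; apply: cvgB => //; exact: cvg_cst.
  apply: cvgV; first by rewrite gt_eqF// ltr_wpDr// sqr_ge0.
  by apply: cvgD; [exact: cvg_cst|exact: cvgM].
apply/lee_addgt0Pr => e e0.
have /cvgrPdist_lt/(_ _ e0)/nbhs_ballP[d /= d0 dP] := psi_cvg.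
have a0 : 0 < mu / 2 + d / 2 by rewrite ltr_wpDl ?divr_ge0 ?divr_gt0.
have mua : (volume_growth theta rho x0 < (2 * (mu / 2 + d / 2))%:E)%E.
  by rewrite E_mu lte_fin; lra.
have := lambda0_ess_le_exp hG htheta_gt0 theta_inf hmet K0 degree_le
  (fun x y Exy => (hmM x y Exy).2) a0 mua.
move=> /le_trans; apply; rewrite -EFinD lee_fin.
have := dP (mu / 2 + d / 2); rewrite /ball/= opprD addrA subrr sub0r normrN.
rewrite gtr0_norm ?divr_gt0// ltr_pdivrMr// ltr_pMr// ltr1n => /(_ isT).
by rewrite ltr_norml -/(psi _) => /andP[h _]; lra.
Qed.
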